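(* There exist absolute constants $\delta>0$ and $\widetilde{M}>0$ such that the following holds. Let $P$ be a polynomial (in one complex variable $z$, with complex coefficients) with $\lVert P\rVert_{\mathcal{F}}\le\delta$. Then there exists $w\in\mathbb{C}$ with $|w|=1$ such that \[ \lVert w(1+P)-1\rVert_{\mathcal{F}}\;\le\;\widetilde{M}\,\bigl\|\,\lvert 1+P\rvert-1\,\bigr\|_{\mathcal{F}}. \] One may take $\delta=1/4601$ and $\widetilde{M}=23003$.
   Context: For any measurable function $F:\mathbb{C}\to\mathbb{C}$ (not necessarily holomorphic), the Fock norm is defined by \[ \lVert F\rVert_{\mathcal{F}}^2:=\frac{1}{\pi}\int_{\mathbb{C}}|F(z)|^2 e^{-|z|^2}\,dm(z), \] with $m$ the Lebesgue measure on $\mathbb{C}\cong\mathbb{R}^2$. *)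

(* Defs.v *)
From mathcomp Require Import all_boot all_order all_algebra.
From mathcomp Require Import complex.
From mathcomp Require Import all_classical all_reals all_analysis.

Set Implicit Arguments.
Unset Strict Implicit.
Unset Printing Implicit Defensive.

Import Order.TTheory GRing.Theory Num.Theory.
Import numFieldNormedType.Exports.

Local Open Scope classical_set_scope.
Local Open Scope ring_scope.
Local Open Scope complex_scope.
Local Open Scope ereal_scope.

(* R[i] carries no measurable structure in the library: the point z = x + iy is
   the pair (x, y) : R * R, with planar Lebesgue measure.  The value is extended
   real, since the integral may diverge for a general F.
   [Normc.normc] is the modulus as an element of R, whereas `|z| is the same
   number as an element of R[i]. *)
Definition fock_norm (R : realType) (F : R[i] -> R[i]) : \bar R :=
  ((pi^-1)%:E *
   \int[lebesgue_measure \x lebesgue_measure]_(p in [set: R * R])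
     ((Normc.normc (F (p.1 +i* p.2)) ^+ 2
       * expR (- Normc.normc (p.1 +i* p.2) ^+ 2))%R)%:E) `^ (2^-1)%R.

Definition phase_stable (R : realType) (delta M : R) : Prop :=
  forall P : {poly R[i]},
    fock_norm (fun z => P.[z]%R) <= delta%:E ->
    exists2 w : R[i], `|w|%R = 1%R &
      fock_norm (fun z => w * (1 + P.[z]) - 1)%R <=
      M%:E * fock_norm (fun z => `|1 + P.[z]| - 1)%R.

(* Main.v *)
From HB Require Import structures.
Require Import Defs.
From mathcomp Require Import all_boot all_order all_algebra.
From mathcomp Require Import complex ring lra.
From mathcomp Require Import all_classical all_reals all_analysis.
From mathcomp Require Import measurable_realfun.

(* Multiply by a phase so that [f = w (1 + P) = 1 + x + Q] with [x] real and
   [Q 0 = 0].  Since [Re f <= |f|], the positive part of [Re Q] is at most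
   [||f| - 1| + |x|] pointwise, so everything reduces to the one-sided estimate
   [||Q|| <= C ||(Re Q)^+||] for polynomials vanishing at [0]; smallness of [P]
   is only used to see that [|x|] is controlled by [|| |f| - 1 ||].

   For the one-sided estimate put
     [K(z, w) = exp (- b |z - w|^2 - |z|^2 / 2 - |w|^2 / 2)].
   The sub-mean value property of [z |-> Q z exp (- conj q (z - q))] gives
     [|Q q| exp (- |q|^2) <= C int K(q, w) |Q w| dw],
   whereas the mean value property shows that
     [int Re Q(z) K(z, w) dz = C Re Q(th w) exp (- (1 + th) |w|^2 / 2)]
   with [th = b / (b + 1/2)] small.  Integrating the first inequality against
   the negative part [(Re Q)^-] and exchanging the integrals, the second one
   replaces [(Re Q)^-] by [(Re Q)^+] up to a term in which all Taylor
   coefficients of [Q] but the first are damped by a power of [th].  The first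
   coefficient is handled separately, and [||Q||^2 = 2 ||Re Q||^2] concludes. *)

Import Order.TTheory GRing.Theory Num.Theory.
Import numFieldNormedType.Exports.

Local Open Scope classical_set_scope.
Local Open Scope ring_scope.

(** * Invariance of planar Lebesgue measure *)

Notation lam1 := lebesgue_measure.
Notation lam2 := (product_measure1 lebesgue_measure lebesgue_measure).

(** * Changes of variables on the line *)

Section LineIntegrals.
Context {R : realType}.
Local Notation RM := (measurableTypeR R).
Local Open Scope ereal_scope.

(** The image of Lebesgue measure under [x + a] agrees with it on half-open intervals, hence on all
    measurable sets by uniqueness. *)
Lemma ge0_integral_translation (f : R -> \bar R) (a : R) :
  measurable_fun [set: R] f -> (forall x, 0 <= f x) ->
  \int[lam1]_x f (x + a)%R = \int[lam1]_x f x.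
Proof.
move=> mf f0.
have mT : measurable_fun setT (fun x : RM => (x + a)%R : RM).
  by apply: measurable_funD => //.
have H A : measurable A -> lam1 A = pushforward lam1 (fun x : RM => (x + a)%R : RM) A.
  move=> mA; apply: lebesgue_measure_unique => //= _ [[b c]] _ <-.
  rewrite /pushforward (_ : _ @^-1` _ = `](b - a)%R, (c - a)%R]%classic); last first.
    by apply/seteqP; split => x /=; rewrite !in_itv/= ltrBlDr lerBrDr.
  rewrite !lebesgue_measure_itv/= !lte_fin ltrD2r.
  by case: ifP => // _; rewrite -!EFinB; congr EFin; ring.
transitivity (\int[pushforward lam1 (fun x : RM => (x + a)%R : RM)]_x f x).
  by rewrite ge0_integral_pushforward.
by apply: eq_measure_integral => A mA _; exact: (esym (H _ _)).
Qed.

(** The same uniqueness argument, for the image measure rescaled by [c]. *)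
Lemma ge0_integral_dilation (f : R -> \bar R) (c : R) :
  measurable_fun [set: R] f -> (forall x, 0 <= f x) -> (0 < c)%R ->
  \int[lam1]_x f (c * x)%R = (c^-1)%:E * \int[lam1]_x f x.
Proof.
move=> mf f0 c0.
have mT : measurable_fun setT (fun x : RM => (c * x)%R : RM).
  by apply: measurable_funM => //.
pose mu0 := mscale (NngNum (ltW c0))
  (pushforward lam1 (fun x : RM => (c * x)%R : RM)).
pose mu := mu0 mT.
have H A : measurable A -> lam1 A = mu A.
  move=> mA; apply: lebesgue_measure_unique => //= _ [[b d]] _ <-.
  rewrite /mu /mu0 /mscale /= /pushforward.
  rewrite (_ : _ @^-1` _ = `](b / c)%R, (d / c)%R]%classic); last first.
    apply/seteqP; split => x /=;
      by rewrite !in_itv/= ltr_pdivrMr// ler_pdivlMr// ![(x * c)%R]mulrC.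
  rewrite !lebesgue_measure_itv/= !lte_fin ltr_pM2r ?invr_gt0//.
  case: ifP => // _; rewrite ?mule0// -!EFinB -EFinM; congr EFin.
  by field; rewrite gt_eqF.
have -> : \int[lam1]_x f x = \int[mu]_x f x.
  by apply: eq_measure_integral => A mA _; exact: H.
rewrite ge0_integral_mscale//= ge0_integral_pushforward//=.
by rewrite muleA -EFinM mulVf ?gt_eqF// mul1e.
Qed.

End LineIntegrals.

(** * Shears, translations, dilations and rotations of the plane *)

Section PlaneIntegrals.
Context {R : realType}.
Local Open Scope ereal_scope.
Implicit Types f : R * R -> \bar R.

(** By Tonelli, with the sheared coordinate integrated first, a shear is a translation on each
    line. *)
Lemma ge0_plane_shear1 f (t : R) : measurable_fun [set: R * R] f ->
  (forall p, 0 <= f p) ->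
  \int[lam2]_p f (p.1 + t * p.2, p.2)%R = \int[lam2]_p f p.
Proof.
move=> mf f0.
have ms : measurable_fun setT (fun p : R * R => f (p.1 + t * p.2, p.2)%R).
  apply: measurableT_comp => //; apply: measurable_fun_pair => //.
  by apply: measurable_funD => //; apply: measurable_funM.
rewrite (fubini_tonelli2 (m1 := lam1) (m2 := lam1) f mf f0).
rewrite (fubini_tonelli2 (m1 := lam1) (m2 := lam1) _ ms (fun=> f0 _)).
apply: eq_integral => y _; rewrite /fubini_G /=.
apply: (ge0_integral_translation (fun x => f (x, y))) => //.
by apply: measurableT_comp => //.
Qed.

Lemma ge0_plane_shear2 f (t : R) : measurable_fun [set: R * R] f ->
  (forall p, 0 <= f p) ->
  \int[lam2]_p f (p.1, p.2 + t * p.1)%R = \int[lam2]_p f p.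
Proof.
move=> mf f0.
have ms : measurable_fun setT (fun p : R * R => f (p.1, p.2 + t * p.1)%R).
  apply: measurableT_comp => //; apply: measurable_fun_pair => //.
  by apply: measurable_funD => //; apply: measurable_funM.
rewrite (fubini_tonelli1 (m1 := lam1) (m2 := lam1) f mf f0).
rewrite (fubini_tonelli1 (m1 := lam1) (m2 := lam1) _ ms (fun=> f0 _)).
apply: eq_integral => x _; rewrite /fubini_F /=.
apply: (ge0_integral_translation (fun y => f (x, y))) => //.
by apply: measurableT_comp => //.
Qed.

Lemma ge0_plane_translation f (a b : R) : measurable_fun [set: R * R] f ->
  (forall p, 0 <= f p) ->
  \int[lam2]_p f (p.1 + a, p.2 + b)%R = \int[lam2]_p f p.
Proof.
move=> mf f0.
have ms : measurable_fun setT (fun p : R * R => f (p.1 + a, p.2 + b)%R).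
  apply: measurableT_comp => //; apply: measurable_fun_pair => //;
  exact: measurable_funD.
rewrite (fubini_tonelli1 (m1 := lam1) (m2 := lam1) f mf f0).
rewrite (fubini_tonelli1 (m1 := lam1) (m2 := lam1) _ ms (fun=> f0 _)).
pose F := fubini_F lam1 f.
transitivity (\int[lam1]_x F (x + a)%R).
  apply: eq_integral => x _; rewrite /F /fubini_F /=.
  apply: (ge0_integral_translation (fun y => f ((x + a)%R, y))) => //.
  by apply: measurableT_comp => //.
apply: ge0_integral_translation.
  exact: measurable_fun_fubini_tonelli_F.
by move=> x; apply: integral_ge0.
Qed.

Lemma ge0_plane_dilation f (c : R) : measurable_fun [set: R * R] f ->
  (forall p, 0 <= f p) -> (0 < c)%R ->
  \int[lam2]_p f (c * p.1, c * p.2)%R = (c ^- 2)%:E * \int[lam2]_p f p.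
Proof.
move=> mf f0 c0.
have ms : measurable_fun setT (fun p : R * R => f (c * p.1, c * p.2)%R).
  apply: measurableT_comp => //; apply: measurable_fun_pair => //;
  exact: measurable_funM.
rewrite (fubini_tonelli1 (m1 := lam1) (m2 := lam1) f mf f0).
rewrite (fubini_tonelli1 (m1 := lam1) (m2 := lam1) _ ms (fun=> f0 _)).
pose F := fubini_F lam1 f.
have mF : measurable_fun setT F by exact: measurable_fun_fubini_tonelli_F.
have F0 x : 0 <= F x by apply: integral_ge0.
transitivity (\int[lam1]_x ((c^-1)%:E * F (c * x)%R)).
  apply: eq_integral => x _; rewrite /F /fubini_F /=.
  apply: (ge0_integral_dilation (fun y => f ((c * x)%R, y))) => //.
  by apply: measurableT_comp => //.
have mFc : measurable_fun setT (fun x : R => F (c * x)%R).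
  by apply: measurableT_comp => //; exact: measurable_funM.
have c'0 : 0 <= (c^-1)%:E by rewrite lee_fin invr_ge0 ltW.
rewrite (ge0_integralZl lam1 measurableT mFc (fun x _ => F0 _) c'0).
by rewrite ge0_integral_dilation// muleA -EFinM -invfM.
Qed.

(* A rotation of angle other than a straight one is a product of three shears. *)
Lemma ge0_plane_rotation f (c s : R) : measurable_fun [set: R * R] f ->
  (forall p, 0 <= f p) -> (c ^+ 2 + s ^+ 2 = 1)%R -> (1 + c != 0)%R ->
  \int[lam2]_p f (c * p.1 - s * p.2, s * p.1 + c * p.2)%R = \int[lam2]_p f p.
Proof.
move=> mf f0 cs c1.
(* With [c] and [s] the cosine and sine, [t] is minus the tangent of the half angle; the shears are
   [t], then [s] in the other direction, then [t] again. *)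
pose t := (- (s / (1 + c)))%R.
pose g1 p := f (p.1 + t * p.2, p.2)%R.
pose g2 p := g1 (p.1, p.2 + s * p.1)%R.
have mg1 : measurable_fun setT g1.
  apply: measurableT_comp => //; apply: measurable_fun_pair => //.
  by apply: measurable_funD => //; apply: measurable_funM.
have mg2 : measurable_fun setT g2.
  apply: measurableT_comp => //; apply: measurable_fun_pair => //.
  by apply: measurable_funD => //; apply: measurable_funM.
have g10 p : 0 <= g1 p by exact: f0.
have g20 p : 0 <= g2 p by exact: f0.
rewrite -(ge0_plane_shear1 f t)// -(ge0_plane_shear2 g1 s)//.
rewrite -(ge0_plane_shear1 g2 t)//.
apply: eq_integral => p _; rewrite /g2 /g1 /= /t.
have s2 : (s ^+ 2 = (1 - c) * (1 + c))%R by lra.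
have e : (s * (s / (1 + c)) = 1 - c)%R.
  by rewrite mulrA -expr2 s2 mulfK.
congr (f (_, _)).
  transitivity (p.1 - s / (1 + c) * p.2 - s / (1 + c) * p.2 -
    (s * (s / (1 + c))) * p.1 + (s * (s / (1 + c))) * (s / (1 + c)) * p.2)%R;
    last by ring.
  by rewrite e; field.
transitivity (p.2 - (s * (s / (1 + c))) * p.2 + s * p.1)%R; last by ring.
by rewrite e; ring.
Qed.

(* Invariance on nonnegative functions passes to all measurable functions
   through positive and negative parts, without integrability. *)
Lemma plane_invariance (T : R * R -> R * R) :
  measurable_fun [set: R * R] T ->
  (forall f, measurable_fun [set: R * R] f -> (forall p, 0 <= f p) ->
    \int[lam2]_p f (T p) = \int[lam2]_p f p) ->
  forall F : R * R -> R, measurable_fun [set: R * R] F ->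
    (\int[lam2]_p F (T p) = \int[lam2]_p F p)%R.
Proof.
move=> mT invT F mF; rewrite /Rintegral; congr fine.
have mEF : measurable_fun [set: R * R] (EFin \o F) by exact/measurable_EFinP.
rewrite integralE [RHS]integralE; congr (_ - _).
  rewrite -(invT _ (measurable_funepos mEF) (funepos_ge0 _)).
  by apply: eq_integral => p _; rewrite !funeposE.
rewrite -(invT _ (measurable_funeneg mEF) (funeneg_ge0 _)).
by apply: eq_integral => p _; rewrite !funenegE.
Qed.

End PlaneIntegrals.

(** * Gaussian decay *)

Section Decay.
Context {R : realType}.
Implicit Types (F h : R * R -> R) (p : R * R).

Definition nsq p : R := p.1 ^+ 2 + p.2 ^+ 2.

Lemma nsq_ge0 p : 0 <= nsq p.
Proof. by rewrite addr_ge0 ?sqr_ge0. Qed.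

Lemma measurable_nsq : measurable_fun [set: R * R] nsq.
Proof. by apply: measurable_funD; exact: measurable_funX. Qed.

Lemma measurable_gauss (a : R) :
  measurable_fun [set: R * R] (fun p => expR (a * nsq p)).
Proof.
by apply: measurableT_comp => //; apply: measurable_funM => //; exact: measurable_nsq.
Qed.

(** Rescaling reduces to [a = 1], where Tonelli gives the square of the one-dimensional Gaussian
    integral. *)
Lemma integral_gauss_plane (a : R) : 0 < a ->
  (\int[lam2]_p (expR (- a * nsq p))%:E = (pi / a)%:E)%E.
Proof.
move=> a0; pose f (p : R * R) : \bar R := (expR (- nsq p))%:E.
have mf : measurable_fun setT f.
  apply/measurable_EFinP.
  by under eq_fun do rewrite -mulN1r; exact: measurable_gauss.
have f0 p : (0 <= f p)%E by rewrite lee_fin expR_ge0.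
have -> : (\int[lam2]_p (expR (- a * nsq p))%:E =
           \int[lam2]_p f (Num.sqrt a * p.1, Num.sqrt a * p.2)%R)%E.
  apply: eq_integral => p _; rewrite /f; congr (expR _)%:E.
  by rewrite /nsq /= !exprMn sqr_sqrtr ?ltW//; ring.
rewrite ge0_plane_dilation ?sqrtr_gt0// sqr_sqrtr ?ltW//.
suff -> : (\int[lam2]_p f p = pi%:E)%E by rewrite -EFinM mulrC.
rewrite fubini_tonelli1//.
have g0 (x : R) : (0 <= (gauss_fun x)%:E)%E by rewrite lee_fin gauss_fun_ge0.
have mg : measurable_fun setT (EFin \o @gauss_fun R).
  by apply/measurable_EFinP; exact: measurable_gauss_fun.
transitivity (\int[lam1]_(x in [set: R]) ((gauss_fun x)%:E * (Num.sqrt pi)%:E))%E.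
  apply: eq_integral => x _; rewrite /fubini_F /= -(@integralT_gauss R).
  rewrite -ge0_integralZl//.
  by apply: eq_integral => y _; rewrite -EFinM /f /nsq opprD expRD.
rewrite ge0_integralZr//.
by rewrite integralT_gauss -EFinM -expr2 sqr_sqrtr// pi_ge0.
Qed.

(** The working class of integrands: domination by some Gaussian yields integrability. *)
Definition gdecay F := measurable_fun [set: R * R] F /\
  exists c b : R, 0 < b /\ forall p, `|F p| <= c * expR (- b * nsq p).

(** Growth below every Gaussian exponential. The class contains the real and imaginary parts of
    polynomials, is closed under the operations used below, and multiplies [gdecay] into itself, so
    degrees need not be tracked. *)
Definition subgauss h := measurable_fun [set: R * R] h /\
  forall b : R, 0 < b -> exists c : R, forall p, `|h p| <= c * expR (b * nsq p).

Lemma gauss_integrable (a : R) : 0 < a ->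
  lam2.-integrable [set: R * R] (fun p => (expR (- a * nsq p))%:E).
Proof.
move=> a0; apply/integrableP; split.
  by apply/measurable_EFinP; exact: measurable_gauss.
under eq_integral do rewrite /= ger0_norm ?expR_ge0//.
by rewrite integral_gauss_plane// ltry.
Qed.

Lemma gdecay_integrable F : gdecay F ->
  lam2.-integrable [set: R * R] (EFin \o F).
Proof.
move=> [mF [c [b [b0 Fc]]]].
have ig := @integrableZl _ _ _ _ _ measurableT c _ (gauss_integrable _ b0).
apply: (le_integrable measurableT _ _ ig).
  exact/measurable_EFinP.
by move=> p _; rewrite -EFinM lee_fin (le_trans (Fc p))// ler_norm.
Qed.

Lemma subgauss_gdecay h F : subgauss h -> gdecay F -> gdecay (fun p => h p * F p).
Proof.
move=> [mh sh] [mF [c [b [b0 Fc]]]]; split; first exact: measurable_funM.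
(* Half of the decay rate of [F] is spent on absorbing [h]. *)
have b20 : 0 < b / 2 by rewrite divr_gt0.
have [c' hc] := sh _ b20.
exists (c' * c), (b / 2); split=> //.
move=> p; rewrite normrM (le_trans (ler_pM _ _ (hc p) (Fc p)))//.
rewrite mulrACA -expRD.
suff -> : b / 2 * nsq p + - b * nsq p = - (b / 2) * nsq p by [].
by field.
Qed.

Lemma gdecayD F1 F2 : gdecay F1 -> gdecay F2 -> gdecay (fun p => F1 p + F2 p).
Proof.
move=> [m1 [c1 [b1 [b10 F1c]]]] [m2 [c2 [b2 [b20 F2c]]]].
split; first exact: measurable_funD.
exists (`|c1| + `|c2|), (Num.min b1 b2); split; first by rewrite lt_min b10.
move=> p; rewrite (le_trans (ler_normD _ _))// mulrDl lerD//.
  rewrite (le_trans (F1c p))// (le_trans (ler_wpM2r (expR_ge0 _) (ler_norm _)))//.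
  rewrite ler_wpM2l// ler_expR !mulNr lerN2 ler_wpM2r ?nsq_ge0//.
  by rewrite ge_min lexx.
rewrite (le_trans (F2c p))// (le_trans (ler_wpM2r (expR_ge0 _) (ler_norm _)))//.
rewrite ler_wpM2l// ler_expR !mulNr lerN2 ler_wpM2r ?nsq_ge0//.
by rewrite ge_min lexx orbT.
Qed.

Lemma gdecay_le F1 F2 : measurable_fun [set: R * R] F1 -> gdecay F2 ->
  (forall p, `|F1 p| <= F2 p) -> gdecay F1.
Proof.
move=> mF1 [m2 [c2 [b2 [b20 F2c]]]] F12; split=> //.
exists c2, b2; split=> // p; rewrite (le_trans (F12 p))// (le_trans _ (F2c p))//.
exact: ler_norm.
Qed.

Lemma gdecay_gauss (a : R) : 0 < a -> gdecay (fun p => expR (- a * nsq p)).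
Proof.
move=> a0; split; first exact: measurable_gauss.
by exists 1, a; split=> // p; rewrite mul1r ger0_norm ?expR_ge0.
Qed.

Lemma subgauss_le h1 h2 : measurable_fun [set: R * R] h1 -> subgauss h2 ->
  (forall p, `|h1 p| <= h2 p) -> subgauss h1.
Proof.
move=> mh1 [m2 sh2] h12; split=> // b b0; have [c hc] := sh2 b b0.
exists c => p; rewrite (le_trans (h12 p))// (le_trans _ (hc p))//.
exact: ler_norm.
Qed.

Lemma subgauss_cst (c : R) : subgauss (fun=> c).
Proof.
split=> // b b0; exists `|c| => p; rewrite ler_peMr//.
by rewrite -expR0 ler_expR mulr_ge0 ?nsq_ge0// ltW.
Qed.

Lemma subgaussD h1 h2 : subgauss h1 -> subgauss h2 ->
  subgauss (fun p => h1 p + h2 p).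
Proof.
move=> [m1 s1] [m2 s2]; split=> [|b b0]; first exact: measurable_funD.
have [[c1 hc1] [c2 hc2]] := (s1 b b0, s2 b b0).
exists (c1 + c2) => p; rewrite (le_trans (ler_normD _ _))// mulrDl lerD//.
Qed.

Lemma subgaussM h1 h2 : subgauss h1 -> subgauss h2 ->
  subgauss (fun p => h1 p * h2 p).
Proof.
move=> [m1 s1] [m2 s2]; split=> [|b b0]; first exact: measurable_funM.
have b20 : 0 < b / 2 by rewrite divr_gt0.
have [[c1 hc1] [c2 hc2]] := (s1 _ b20, s2 _ b20).
exists (c1 * c2) => p; rewrite normrM (le_trans (ler_pM _ _ (hc1 p) (hc2 p)))//.
rewrite mulrACA -expRD.
suff -> : b / 2 * nsq p + b / 2 * nsq p = b * nsq p by [].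
by field.
Qed.

Lemma subgaussN h : subgauss h -> subgauss (fun p => - h p).
Proof.
move=> [m s]; split=> [|b b0]; first exact: measurableT_comp.
by have [c hc] := s b b0; exists c => p; rewrite normrN.
Qed.

Lemma subgaussX h n : subgauss h -> subgauss (fun p => h p ^+ n).
Proof.
move=> sh; elim: n => [|n IH].
  by under eq_fun do rewrite expr0; exact: subgauss_cst.
by under eq_fun do rewrite exprS; exact: subgaussM.
Qed.

Lemma subgauss_norm h : subgauss h -> subgauss (fun p => `|h p|).
Proof.
move=> [m s]; split=> [|b b0]; first exact: measurableT_comp.
by have [c hc] := s b b0; exists c => p; rewrite normr_id.
Qed.

Lemma subgauss_max h1 h2 : subgauss h1 -> subgauss h2 ->
  subgauss (fun p => Num.max (h1 p) (h2 p)).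
Proof.
move=> s1 s2; have s3 := subgaussD _ _ (subgauss_norm _ s1) (subgauss_norm _ s2).
apply: (subgauss_le _ _ _ s3).
  by apply: measurable_maxr; [case: s1|case: s2].
by move=> p; rewrite /Num.max; case: ifP; rewrite ?lerDl ?lerDr.
Qed.

Lemma subgauss_nsq : subgauss nsq.
Proof.
split=> [|b b0]; first exact: measurable_nsq.
exists b^-1 => p; rewrite ger0_norm ?nsq_ge0// -ler_pdivrMl ?invr_gt0//.
by rewrite invrK (le_trans _ (expR_ge1Dx _))// lerDr.
Qed.

Lemma le_sqr_norm (x y : R) : x ^+ 2 <= y -> `|x| <= 1 + y.
Proof. by move=> xy; rewrite ler_norml; apply/andP; split; nra. Qed.

Lemma subgauss_fst : subgauss fst.
Proof.
apply: (subgauss_le _ _ _ (subgaussD _ _ (subgauss_cst 1) subgauss_nsq)) => // p.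
by apply: le_sqr_norm; rewrite lerDl sqr_ge0.
Qed.

Lemma subgauss_snd : subgauss snd.
Proof.
apply: (subgauss_le _ _ _ (subgaussD _ _ (subgauss_cst 1) subgauss_nsq)) => // p.
by apply: le_sqr_norm; rewrite lerDr sqr_ge0.
Qed.

Lemma subgauss_sqrt h : subgauss h -> subgauss (fun p => Num.sqrt (h p)).
Proof.
move=> sh; have s1 := subgaussD _ _ (subgauss_cst 1) (subgauss_norm _ sh).
apply: (subgauss_le _ _ _ s1).
  case: sh => mh _; apply: measurableT_comp => //.
  exact: continuous_measurable_fun (@sqrt_continuous R).
move=> p; apply: le_sqr_norm.
have [h0|h0] := leP 0 (h p); first by rewrite sqr_sqrtr// ler_norm.
by rewrite ltr0_sqrtr// expr0n normr_ge0.
Qed.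

End Decay.

(** * The mean value property *)

Section MeanValue.
Context {R : realType}.
Local Open Scope complex_scope.
Implicit Types (F h rho : R * R -> R) (p : R * R) (Q : {poly R[i]}).

Definition cpt p : R[i] := p.1 +i* p.2.

Lemma Re_mul (x y : R[i]) : complex.Re (x * y) =
  complex.Re x * complex.Re y - complex.Im x * complex.Im y.
Proof. by case: x; case: y. Qed.

Lemma Im_mul (x y : R[i]) : complex.Im (x * y) =
  complex.Re x * complex.Im y + complex.Im x * complex.Re y.
Proof. by case: x; case: y. Qed.

Lemma Re_add (x y : R[i]) : complex.Re (x + y) = complex.Re x + complex.Re y.
Proof. by case: x; case: y. Qed.

Lemma Im_add (x y : R[i]) : complex.Im (x + y) = complex.Im x + complex.Im y.
Proof. by case: x; case: y. Qed.

Lemma Re_opp (x : R[i]) : complex.Re (- x) = - complex.Re x.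
Proof. by case: x. Qed.

(** Horner induction; both parts are carried together because multiplication by the variable mixes
    them. *)
Lemma subgauss_poly Q : subgauss (fun p => complex.Re Q.[cpt p]) /\
  subgauss (fun p => complex.Im Q.[cpt p]).
Proof.
elim/poly_ind: Q => [|Q c [sR sI]].
  by split; under eq_fun do rewrite horner0 /=; exact: subgauss_cst.
split.
  under eq_fun do rewrite hornerMXaddC Re_add Re_mul /=.
  apply: subgaussD (subgauss_cst _); apply: subgaussD; last apply: subgaussN.
    exact: subgaussM subgauss_fst.
  exact: subgaussM subgauss_snd.
under eq_fun do rewrite hornerMXaddC Im_add Im_mul /=.
apply: subgaussD (subgauss_cst _); apply: subgaussD.
  exact: subgaussM subgauss_snd.
exact: subgaussM subgauss_fst.
Qed.

Lemma subgauss_Re Q : subgauss (fun p => complex.Re Q.[cpt p]).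
Proof. by have [] := subgauss_poly Q. Qed.

Lemma subgauss_Im Q : subgauss (fun p => complex.Im Q.[cpt p]).
Proof. by have [] := subgauss_poly Q. Qed.

(** Supplies a rotation which, applied twice, flips the sign of a monomial of degree [n.+1]. As the
    exponent is even, -1 is not a root, so the angle excluded by the decomposition into shears does
    not occur. *)
Lemma unit_root_of_opp1 (n : nat) : exists c s : R,
  [/\ c ^+ 2 + s ^+ 2 = 1, 1 + c != 0 & (c +i* s) ^+ (2 * n.+1) = -1].
Proof.
pose z : R[i] := (2 * n.+1).-root (-1).
have zn : z ^+ (2 * n.+1) = -1 by rewrite rootCK.
have zN : `|z| = 1.
  apply/eqP; rewrite -(@pexpr_eq1 _ _ (2 * n.+1))//.
  by rewrite -normrX zn normrN normr1.
case: z zn zN => c s zn zN; exists c, s.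
have cs : c ^+ 2 + s ^+ 2 = 1.
  move/(congr1 (fun x => x ^+ 2)): zN.
  by rewrite -add_Re2_Im2 expr1n /= => -[].
split=> //; apply/eqP => c1.
have cN : c = -1 by lra.
have s0 : s = 0 by apply/eqP; rewrite -sqrf_eq0; apply/eqP; move: cs; rewrite cN; lra.
move: zn; rewrite cN s0.
have -> : (-1 +i* 0 : R[i]) = -1 by apply/eqP; rewrite eq_complex /= oppr0 !eqxx.
rewrite exprM sqrrN !expr1n => /eqP.
by rewrite -subr_eq0 opprK (_ : 1 + 1 = 2%:R)// pnatr_eq0.
Qed.

Definition radial rho := forall p q, nsq p = nsq q -> rho p = rho q.

Lemma gdecay_Re_rho Q rho : gdecay rho ->
  gdecay (fun p => complex.Re Q.[cpt p] * rho p).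
Proof. by move=> dr; exact: subgauss_gdecay (subgauss_Re Q) dr. Qed.

(** Rotation by the unit number [z] preserves the integral and multiplies [k] by [z ^+ n.+1]. Two
    rotations turn [k] into [- k], so the integral equals its own opposite. *)
Lemma integral_radial_monomial (k : R[i]) (n : nat) rho :
  gdecay rho -> radial rho ->
  \int[lam2]_p (complex.Re (k * cpt p ^+ n.+1) * rho p) = 0.
Proof.
move=> dr rr.
have [c [s [cs c1 zn]]] := unit_root_of_opp1 n.
pose z : R[i] := c +i* s.
pose I (k : R[i]) := \int[lam2]_p (complex.Re (k * cpt p ^+ n.+1) * rho p).
have dI k' : gdecay (fun p => complex.Re (k' * cpt p ^+ n.+1) * rho p).
  have := gdecay_Re_rho (k' *: 'X^(n.+1)) rho dr.
  by under eq_fun do rewrite hornerZ hornerXn.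
have rot k' : I (k' * z ^+ n.+1) = I k'.
  pose T p : R * R := (c * p.1 - s * p.2, s * p.1 + c * p.2).
  have mT : measurable_fun setT T.
    apply: measurable_fun_pair => //.
      by apply: measurable_funB => //; apply: measurable_funM.
    by apply: measurable_funD => //; apply: measurable_funM.
  have [mI _] := dI k'.
  rewrite /I -(plane_invariance T mT _ _ mI); last first.
    by move=> f mf f0; exact: ge0_plane_rotation.
  apply: eq_Rintegral => p _.
  have -> : rho (T p) = rho p.
    apply: rr; rewrite /nsq /T /=.
    transitivity ((c ^+ 2 + s ^+ 2) * (p.1 ^+ 2 + p.2 ^+ 2)); first by ring.
    by rewrite cs mul1r.
  have -> : cpt (T p) = z * cpt p.
    by apply/eqP; rewrite eq_complex /= eqxx addrC eqxx.
  by rewrite exprMn mulrA.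
suff : I k = - I k by rewrite /I; lra.
rewrite -{1}(rot k) -(rot (k * z ^+ n.+1)) -mulrA -exprD addnn -mul2n zn mulrN1.
rewrite -[RHS]mulN1r /I -RintegralZl//; last exact: gdecay_integrable.
by apply: eq_Rintegral => p _; rewrite mulNr Re_opp mulN1r mulNr.
Qed.

Lemma mean_value_radial Q rho : gdecay rho -> radial rho ->
  \int[lam2]_p (complex.Re Q.[cpt p] * rho p) =
  complex.Re Q.[0] * \int[lam2]_p rho p.
Proof.
move=> dr rr.
(* The exponent varies in the induction: each Horner step moves one factor ['X] of [Q'] into the
   power. *)
have tail n Q' : \int[lam2]_p (complex.Re (Q' * 'X^(n.+1)).[cpt p] * rho p) = 0.
  elim/poly_ind: Q' n => [|Q' c IH] n.
    under eq_Rintegral do rewrite mul0r horner0 mul0r.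
    by rewrite /Rintegral integral0.
  under eq_Rintegral do
    rewrite mulrDl -mulrA -exprS hornerD [X in _ + X]hornerCM hornerXn Re_add mulrDl.
  rewrite RintegralD// ?IH ?integral_radial_monomial ?addr0//.
    exact/gdecay_integrable/gdecay_Re_rho.
  have := gdecay_Re_rho (c%:P * 'X^(n.+1)) rho dr.
  under eq_fun do rewrite hornerCM hornerXn.
  exact: gdecay_integrable.
elim/poly_ind: Q => [|Q c _].
  under eq_Rintegral do rewrite horner0 mul0r.
  by rewrite horner0 mul0r /Rintegral integral0.
under eq_Rintegral do rewrite -(expr1 'X) hornerD hornerC Re_add mulrDl.
rewrite RintegralD//; last 2 first.
- exact/gdecay_integrable/gdecay_Re_rho.
- exact/gdecay_integrable/(subgauss_gdecay _ _ (subgauss_cst _)).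
rewrite tail add0r RintegralZl//; last exact: gdecay_integrable.
by rewrite hornerMXaddC mulr0 add0r.
Qed.

(** Translating [c] to the origin makes the weight radial and replaces [Q] by the polynomial
    [Q (z + c)]. *)
Lemma mean_value_gauss Q (a : R) (c : R * R) : 0 < a ->
  \int[lam2]_p (complex.Re Q.[cpt p] * expR (- a * nsq (p - c))) =
  pi / a * complex.Re Q.[cpt c].
Proof.
move=> a0.
pose T p : R * R := (p.1 + c.1, p.2 + c.2).
have mT : measurable_fun setT T.
  by apply: measurable_fun_pair; exact: measurable_funD.
have mF : measurable_fun setT
    (fun p => complex.Re Q.[cpt p] * expR (- a * nsq (p - c))).
  apply: measurable_funM; first by case: (subgauss_Re Q).
  apply: measurableT_comp => //; apply: measurable_funM => //.
  apply: measurable_funD; apply: measurable_funX => //=.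
    exact: measurable_funB.
  exact: measurable_funB.
rewrite -(plane_invariance T mT _ _ mF); last first.
  by move=> f mf f0; exact: ge0_plane_translation.
under eq_Rintegral => p _.
  have -> : T p - c = p by apply: injective_projections; rewrite /= addrK.
  have -> : Q.[cpt (T p)] = (Q \Po ('X + (cpt c)%:P)).[cpt p].
    by rewrite horner_comp hornerD hornerX hornerC.
  over.
rewrite mean_value_radial; [|exact: gdecay_gauss|by move=> p q ->].
rewrite horner_comp hornerD hornerX hornerC add0r mulrC /Rintegral integral_gauss_plane//.
Qed.

End MeanValue.

(** * The sub-mean value property *)

Section SubMeanValue.
Context {R : realType}.
Local Open Scope complex_scope.
Implicit Types (F h rho : R * R -> R) (p q : R * R) (Q : {poly R[i]}).

Notation nc := Normc.normc.

Lemma normc_sqr (z : R[i]) : nc z ^+ 2 = complex.Re z ^+ 2 + complex.Im z ^+ 2.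
Proof. by case: z => a b /=; rewrite sqr_sqrtr// addr_ge0 ?sqr_ge0. Qed.

Lemma normc_ge0 (z : R[i]) : 0 <= nc z.
Proof. by case: z => a b /=; rewrite sqrtr_ge0. Qed.

Lemma normc_cpt p : nc (cpt p) ^+ 2 = nsq p.
Proof. by rewrite normc_sqr. Qed.

Lemma Re_le_normc (z : R[i]) : complex.Re z <= nc z.
Proof.
have [z0|z0] := leP (complex.Re z) 0; first exact: le_trans (normc_ge0 z).
rewrite -(@ler_pXn2r _ 2%N) ?nnegrE ?normc_ge0 ?(ltW z0)// normc_sqr.
by rewrite lerDl sqr_ge0.
Qed.

Lemma normr_Re_le_normc (z : R[i]) : `|complex.Re z| <= nc z.
Proof.
rewrite ler_norml Re_le_normc andbT lerNl -Re_opp (le_trans (Re_le_normc _))//.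
by rewrite normcN.
Qed.

Lemma exists_phase (z : R[i]) : exists2 g : R[i], nc g = 1 & g * z = (nc z)%:C.
Proof.
have [z0|z0] := eqVneq (nc z) 0.
  by exists 1; rewrite ?Normc.normc1// mul1r z0 (Normc.eq0_normc z0).
exists ((nc z)^-1%:C * z^*).
  rewrite Normc.normcM [X in X * _](_ : _ = (nc z)^-1); last first.
    by rewrite /= expr0n addr0 sqrtr_sqr ger0_norm// invr_ge0 normc_ge0.
  rewrite [X in _ * X](_ : _ = nc z) ?mulVf//.
  by case: z {z0} => a b /=; rewrite sqrrN.
rewrite -mulrA (_ : z^* * z = (nc z ^+ 2)%:C).
  by rewrite -rmorphM expr2 mulrA mulVf// mul1r.
rewrite normc_sqr; case: z {z0} => a b; apply/eqP; rewrite eq_complex /=.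
by apply/andP; split; apply/eqP; ring.
Qed.

Lemma subgauss_normc Q : subgauss (fun p => nc Q.[cpt p]).
Proof.
have -> : (fun p => nc Q.[cpt p]) =
    (fun p => Num.sqrt (complex.Re Q.[cpt p] ^+ 2 + complex.Im Q.[cpt p] ^+ 2)).
  by apply/funext => p; rewrite -normc_sqr sqrtr_sqr ger0_norm ?normc_ge0.
by apply: subgauss_sqrt; apply: subgaussD; apply: subgaussX;
  [exact: subgauss_Re|exact: subgauss_Im].
Qed.

(** After multiplication by a phase, the value at 0 is real and equal to its modulus; the mean value
    property for the real part then applies, and Re is at most the modulus. *)
Lemma sub_mean_value Q (a : R) : 0 < a ->
  pi / a * nc Q.[0] <= \int[lam2]_p (nc Q.[cpt p] * expR (- a * nsq p)).
Proof.
move=> a0; have [g g1 gQ] := exists_phase Q.[0].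
have := mean_value_gauss (g%:P * Q) a 0 a0.
rewrite [cpt 0](_ : _ = 0)// hornerCM gQ /= => <-.
under eq_Rintegral do rewrite subr0.
apply: le_Rintegral => //.
- exact/gdecay_integrable/(gdecay_Re_rho (g%:P * Q))/gdecay_gauss.
- exact/gdecay_integrable/(subgauss_gdecay _ _ (subgauss_normc _))/gdecay_gauss.
move=> p _; rewrite ler_wpM2r ?expR_ge0// (le_trans (Re_le_normc _))//.
by rewrite hornerCM Normc.normcM g1 mul1r.
Qed.

(** A polynomial substitute for the modulus of exp(-z), with an error in the exponent that vanishes
    as [n] grows. *)
Lemma normc_1subX_le (z : R[i]) (n : nat) :
  nc (1 - z / n.+1%:R%:C) ^+ n.+1 <=
  expR (- complex.Re z + nc z ^+ 2 / (2 * n.+1%:R)).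
Proof.
(* Chosen so that [1 + t] is the squared modulus of [1 - z / n.+1]; then [1 + t <= expR t] is raised
   to the power [n.+1 / 2]. *)
pose t : R := - 2 * complex.Re z / n.+1%:R + nc z ^+ 2 / n.+1%:R ^+ 2.
have n0 : n.+1%:R != 0 :> R by rewrite pnatr_eq0.
have -> : - complex.Re z + nc z ^+ 2 / (2 * n.+1%:R) = n.+1%:R * (t / 2).
  by rewrite /t; field.
rewrite expRM_natl lerXn2r ?nnegrE ?normc_ge0 ?expR_ge0//.
rewrite -(@ler_pXn2r _ 2%N) ?nnegrE ?normc_ge0 ?expR_ge0//.
rewrite -expRM_natl [2 * (t / 2)](_ : _ = t); last by field.
apply: le_trans (expR_ge1Dx t).
rewrite -fmorphV mulrC.
have -> : nc (1 - n.+1%:R^-1%:C * z) ^+ 2 = 1 + t; last by [].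
rewrite /t !normc_sqr {t}; case: z => x y /=; field.
by rewrite nat1r.
Qed.

Definition fock_kernel (b : R) p q : R :=
  expR (- b * nsq (p - q) - nsq p / 2 - nsq q / 2).


Lemma measurable_fock_kernel_r b p : measurable_fun [set: R * R] (fock_kernel b p).
Proof.
apply: measurableT_comp => //; apply: measurable_funB => //.
  apply: measurable_funB => //; apply: measurable_funM => //.
  by apply: measurable_funD; apply: measurable_funX; exact: measurable_funB.
by apply: measurable_funM => //; exact: measurable_nsq.
Qed.

Lemma fock_kernelC b p q : fock_kernel b p q = fock_kernel b q p.
Proof. by rewrite /fock_kernel /nsq /=; congr expR; ring. Qed.

Lemma gdecay_fock_kernel b p : 0 < b -> gdecay (fock_kernel b p).
Proof.
move=> b0; have h : (0 : R) < 2^-1 by rewrite invr_gt0.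
apply: (gdecay_le _ _ _ (gdecay_gauss _ h)).
  exact: measurable_fock_kernel_r.
move=> q; rewrite ger0_norm ?expR_ge0// ler_expR.
rewrite !mulNr [2^-1 * _]mulrC gerDr subr_le0.
by rewrite (@le_trans _ _ 0) ?divr_ge0 ?nsq_ge0// oppr_le0 mulr_ge0 ?nsq_ge0 ?ltW.
Qed.

(* The sub-mean value property at [q] of the entire function
   [Q(z) exp(- conj q (z - q))], whose modulus turns the Gaussian weight into
   the kernel.  Replacing the exponential by [(1 - conj q (z - q) / n) ^ n] keeps
   everything polynomial; the factor [2] absorbs the error. *)
Lemma sub_mean_value_fock Q (b : R) q : 0 < b ->
  nc Q.[cpt q] * expR (- nsq q) <= 2 * (b + 2^-1) / pi *
    \int[lam2]_p (nc Q.[cpt p] * fock_kernel b q p).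
Proof.
(* The added 1/2 comes from - Re(conj q (z - q)) = (|z - q|^2 - |z|^2 + |q|^2) / 2, which lowers the
   Gaussian rate from [a] to [b]. *)
move=> b0; set a := b + 2^-1.
have a0 : 0 < a by rewrite addr_gt0// invr_gt0.
have [n nq] : exists n : nat, nsq q / (2 * n.+1%:R) <= a.
  exists (Num.trunc (nsq q / (2 * a))).
  rewrite ler_pdivrMr ?mulr_gt0// mulrCA mulrA -ler_pdivrMl ?mulr_gt0//.
  by rewrite mulrC ltW// truncnS_gt.
(* The rate is raised by exactly the error of the polynomial substitute; the choice of [n] ensures
   [a' <= 2 * a], whence the factor 2. *)
pose a' := a + nsq q / (2 * n.+1%:R).
have a'0 : 0 < a' by rewrite ltr_wpDr// divr_ge0 ?nsq_ge0// mulr_ge0.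
pose W := (Q \Po ('X + (cpt q)%:P)) *
  (1 - ((cpt q)^* / n.+1%:R%:C) *: 'X) ^+ n.+1.
have WE z : W.[z] = Q.[z + cpt q] * (1 - (cpt q)^* * z / n.+1%:R%:C) ^+ n.+1.
  by rewrite hornerM horner_exp horner_comp !hornerE mulrAC.
have nX (z : R[i]) k : nc (z ^+ k) = nc z ^+ k.
  elim: k => [|k IH]; first by rewrite !expr0 Normc.normc1.
  by rewrite !exprS Normc.normcM IH.
have := sub_mean_value W a' a'0.
rewrite WE mulr0 mul0r subr0 expr1n mulr1 add0r => SW.
pose T p : R * R := (p.1 - q.1, p.2 - q.2).
pose F p := nc Q.[cpt (p + q)] *
  expR (- a * nsq p - complex.Re ((cpt q)^* * cpt p)).
have mT : measurable_fun setT T.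
  by apply: measurable_fun_pair; exact: measurable_funB.
have FT p : F (T p) = expR (nsq q) * (nc Q.[cpt p] * fock_kernel b q p).
  rewrite /F (_ : T p + q = p); last first.
    by apply: injective_projections; rewrite /= subrK.
  rewrite mulrCA -expRD; congr (_ * expR _).
  by rewrite /T /a /cpt /nsq /=; field.
have dK : gdecay (fun p => nc Q.[cpt p] * fock_kernel b q p).
  exact: subgauss_gdecay (subgauss_normc _) (gdecay_fock_kernel _ _ b0).
have dF : gdecay F.
  have -> : F = fun p => nc (Q \Po ('X + (cpt q)%:P)).[cpt p] *
      expR (- a * nsq p - complex.Re ((cpt q)^* * cpt p)).
    by apply/funext => p; rewrite horner_comp !hornerE.
  apply: subgauss_gdecay (subgauss_normc _) _; split.
    apply: measurableT_comp => //; apply: measurable_funB.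
      by apply: measurable_funM => //; exact: measurable_nsq.
    rewrite /=; apply: measurable_funB; exact: measurable_funM.
  (* Completing the square absorbs the linear term at the price of half the decay rate. *)
  exists (expR (nsq q / (2 * a))), (a / 2); split; first by rewrite divr_gt0.
  move=> p; rewrite ger0_norm ?expR_ge0// -expRD ler_expR.
  rewrite -subr_ge0 (_ : _ - _ = a / 2 * ((p.1 + q.1 / a) ^+ 2 + (p.2 + q.2 / a) ^+ 2)).
    by rewrite mulr_ge0// ?addr_ge0 ?sqr_ge0// divr_ge0// ltW.
  by rewrite /nsq /=; field; rewrite gt_eqF.
have : pi / a' * nc Q.[cpt q] <=
    expR (nsq q) * \int[lam2]_p (nc Q.[cpt p] * fock_kernel b q p).
  rewrite -RintegralZl//; last exact: gdecay_integrable.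
  under [leRHS]eq_Rintegral do rewrite -FT.
  rewrite (plane_invariance T mT); last 2 first.
  - by move=> f mf f0; exact: (ge0_plane_translation f (- q.1) (- q.2)).
  - by case: dF.
  apply: (le_trans SW); apply: le_Rintegral => //.
  - exact/gdecay_integrable/(subgauss_gdecay _ _ (subgauss_normc _))/gdecay_gauss.
  - exact: gdecay_integrable.
  move=> p _; rewrite WE Normc.normcM nX /F -mulrA ler_wpM2l ?normc_ge0//.
  rewrite (le_trans (ler_wpM2r (expR_ge0 _) (normc_1subX_le _ _)))//.
  rewrite -expRD ler_expR Normc.normcM exprMn normc_cpt.
  rewrite (_ : nc (cpt q)^* ^+ 2 = nsq q); last first.
    by rewrite normc_sqr /= sqrrN.
  rewrite le_eqVlt; apply/orP; left; apply/eqP; rewrite /a'; field.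
  by rewrite nat1r pnatr_eq0.
set I := Rintegral _ _ _ => H.
have I0 : 0 <= I.
  by apply: Rintegral_ge0 => p _; rewrite mulr_ge0 ?normc_ge0 ?expR_ge0.
have pi0 : 0 < pi :> R := pi_gt0 R.
rewrite expRN ler_pdivrMr ?expR_gt0// mulrAC.
have : nc Q.[cpt q] <= a' / pi * (expR (nsq q) * I).
  by rewrite mulrC -ler_pdivrMr ?divr_gt0// invf_div mulrC.
move/le_trans; apply.
rewrite -[leRHS]mulrA -![_ / pi * _]mulrA; apply: ler_wpM2r.
  by rewrite mulr_ge0 ?invr_ge0 ?(ltW pi0)// mulr_ge0 ?expR_ge0.
by rewrite /a' [leRHS]mulr_natl [leRHS]mulr2n lerD2l.
Qed.

End SubMeanValue.

(** * The Gaussian kernel in double integrals *)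

(* A copy of [lam2]: the library registers the sigma-finite structure of a
   product measure under a key already taken by products of subprobabilities. *)
Section PlaneMeasure.
Context (R : realType).
Local Notation RM := (measurableTypeR R).

Definition plane_measure : set (RM * RM)%type -> \bar R := lam2.
HB.instance Definition _ := Measure.on plane_measure.

(** Squares of an increasing exhaustion of the line suffice: monotonicity puts both coordinates of a
    point in a common set [F n]. *)
Lemma plane_measure_sigma_finite : sigma_finite setT plane_measure.
Proof.
have /sigma_finiteP[F [TF ndF Foo]] := sigma_finiteT (@lebesgue_measure R).
exists (fun n => F n `*` F n).
  rewrite -setXTT TF; apply/seteqP; split=> -[x y] /=; last first.
    by move=> [n _ [? ?]]; split; exists n.
  move=> [[n _ Fx] [k _ Fy]]; exists (maxn n k) => //; split.
    by move: x Fx; exact/subsetPset/ndF/leq_maxl.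
  by move: y Fy; exact/subsetPset/ndF/leq_maxr.
move=> k; have [mF Ffin] := Foo k; split; first exact: measurableX.
by rewrite /plane_measure product_measure1E// lte_mul_pinfty// ge0_fin_numE.
Qed.

HB.instance Definition _ := Measure_isSigmaFinite.Build _ _ _ plane_measure
  plane_measure_sigma_finite.
End PlaneMeasure.

Section DoubleIntegrals.
Context {R : realType}.
Local Open Scope complex_scope.
Implicit Types (F f g h rho : R * R -> R) (p q : R * R) (Q : {poly R[i]}).
Implicit Types (A B : (R * R) * (R * R) -> R).

Notation nc := Normc.normc.

Lemma gdecay_integral F : gdecay F ->
  (\int[lam2]_p (F p)%:E = (\int[lam2]_p F p)%:E)%E.
Proof.
move=> /gdecay_integrable dF; rewrite /Rintegral fineK//.
exact: integrable_fin_num.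
Qed.

Lemma measurable_pairE A : measurable_fun setT A -> measurable_fun setT (EFin \o A).
Proof. by move=> mA; exact/measurable_EFinP. Qed.

Lemma double_integral_swap A : measurable_fun setT A -> (forall x, 0 <= A x) ->
  (\int[lam2]_p \int[lam2]_q (A (p, q))%:E =
   \int[lam2]_q \int[lam2]_p (A (p, q))%:E)%E.
Proof.
move=> mA A0.
have EA0 x : (0 <= (EFin \o A) x)%E by rewrite lee_fin.
exact: (fubini_tonelli (m1 := plane_measure R) (m2 := plane_measure R)
  (EFin \o A) (measurable_pairE _ mA) EA0).
Qed.

Lemma measurable_inner A : measurable_fun setT A -> (forall x, 0 <= A x) ->
  measurable_fun setT (fun p => \int[lam2]_q (A (p, q))%:E)%E.
Proof.
move=> mA A0.
have EA0 x : (0 <= (EFin \o A) x)%E by rewrite lee_fin.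
exact: (measurable_fun_fubini_tonelli_F (m2 := plane_measure R)
  (EFin \o A) (measurable_pairE _ mA) EA0).
Qed.

Lemma measurable_section A p : measurable_fun setT A ->
  measurable_fun setT (fun q => (A (p, q))%:E).
Proof.
move=> mA; apply/measurable_EFinP; apply: (measurableT_comp mA).
exact: measurable_fun_pair.
Qed.

Lemma measurable_nsqB :
  measurable_fun setT (fun x : (R * R) * (R * R) => nsq (x.1 - x.2)).
Proof.
have m1 : measurable_fun setT (fun x : (R * R) * (R * R) => x.1.1 - x.2.1).
  by apply: measurable_funB; exact: measurableT_comp.
have m2 : measurable_fun setT (fun x : (R * R) * (R * R) => x.1.2 - x.2.2).
  by apply: measurable_funB; exact: measurableT_comp.
by apply: measurable_funD; exact: measurable_funX.
Qed.

Lemma measurable_fock_kernel (b : R) :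
  measurable_fun setT (fun x : (R * R) * (R * R) => fock_kernel b x.1 x.2).
Proof.
apply: measurableT_comp => //; apply: measurable_funB; [apply: measurable_funB|].
- by apply: measurable_funM => //; exact: measurable_nsqB.
- by apply: measurable_funM => //; exact: measurableT_comp measurable_nsq _.
- by apply: measurable_funM => //; exact: measurableT_comp measurable_nsq _.
Qed.

Lemma integral_gauss_center (b : R) p : 0 < b ->
  (\int[lam2]_q (expR (- b * nsq (p - q)))%:E = (pi / b)%:E)%E.
Proof.
move=> b0; rewrite -(integral_gauss_plane b b0).
rewrite -(ge0_plane_translation (fun q => (expR (- b * nsq q))%:E) (- p.1) (- p.2)).
- by apply: eq_integral => q _; congr (expR (_ * _))%:E; rewrite /nsq /=; ring.
- by apply/measurable_EFinP; exact: measurable_gauss.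
- by move=> q; rewrite lee_fin expR_ge0.
Qed.

Lemma double_integral_gauss (b : R) f : 0 < b ->
  measurable_fun setT f -> (forall p, 0 <= f p) ->
  (\int[lam2]_p \int[lam2]_q (f p * expR (- b * nsq (p - q)))%:E =
   (pi / b)%:E * \int[lam2]_p (f p)%:E)%E.
Proof.
move=> b0 mf f0.
have me p : measurable_fun setT (fun q => (expR (- b * nsq (p - q)))%:E).
  apply/measurable_EFinP; apply: measurableT_comp => //; apply: measurable_funM => //.
  by apply: measurable_funD; apply: measurable_funX; exact: measurable_funB.
transitivity (\int[lam2]_p ((f p)%:E * (pi / b)%:E))%E.
  apply: eq_integral => p _; rewrite -(integral_gauss_center b p b0) -ge0_integralZl//.
  - exact: me.
  - by rewrite lee_fin.
have mEf : measurable_fun setT (EFin \o f) by exact/measurable_EFinP.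
by rewrite ge0_integralZr ?lee_fin ?divr_ge0 ?pi_ge0 ?(ltW b0)// 1?muleC// => p _;
  rewrite lee_fin.
Qed.

(* Young's inequality for the Gaussian convolution, in bilinear form. *)
Lemma double_integral_fock_le (b t : R) f g : 0 < b -> 0 < t ->
  measurable_fun setT f -> (forall p, 0 <= f p) ->
  measurable_fun setT g -> (forall p, 0 <= g p) ->
  (\int[lam2]_p \int[lam2]_q (f p * g q * fock_kernel b p q)%:E <=
   (pi / (2 * b))%:E * (t%:E * \int[lam2]_p (f p ^+ 2 * expR (- nsq p))%:E +
     t^-1%:E * \int[lam2]_p (g p ^+ 2 * expR (- nsq p))%:E))%E.
Proof.
move=> b0 t0 mf f0 mg g0.
have meg : measurable_fun setT (fun p : R * R => expR (- nsq p)).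
  by under eq_fun do rewrite -mulN1r; exact: measurable_gauss.
pose f2 p := t / 2 * (f p ^+ 2 * expR (- nsq p)).
pose g2 p := t^-1 / 2 * (g p ^+ 2 * expR (- nsq p)).
have mf2 : measurable_fun setT f2.
  by apply: measurable_funM => //; apply: measurable_funM => //; exact: measurable_funX.
have mg2 : measurable_fun setT g2.
  by apply: measurable_funM => //; apply: measurable_funM => //; exact: measurable_funX.
have f20 p : 0 <= f2 p.
  by rewrite mulr_ge0 ?divr_ge0 ?(ltW t0)// mulr_ge0 ?sqr_ge0 ?expR_ge0.
have g20 p : 0 <= g2 p.
  by rewrite mulr_ge0 ?divr_ge0 ?invr_ge0 ?(ltW t0)// mulr_ge0 ?sqr_ge0 ?expR_ge0.
pose G (x : (R * R) * (R * R)) := expR (- b * nsq (x.1 - x.2)).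
have mG : measurable_fun setT G.
  by apply: measurableT_comp => //; apply: measurable_funM => //; exact: measurable_nsqB.
pose A x := f2 x.1 * G x.
pose B x := g2 x.2 * G x.
pose K (x : (R * R) * (R * R)) := f x.1 * g x.2 * fock_kernel b x.1 x.2.
have mA : measurable_fun setT A.
  by apply: measurable_funM => //; exact: measurableT_comp.
have mB : measurable_fun setT B.
  by apply: measurable_funM => //; exact: measurableT_comp.
have mK : measurable_fun setT K.
  apply: measurable_funM; last exact: measurable_fock_kernel.
  by apply: measurable_funM; exact: measurableT_comp.
have A0 x : 0 <= A x by rewrite mulr_ge0 ?expR_ge0.
have B0 x : 0 <= B x by rewrite mulr_ge0 ?expR_ge0.
have K0 x : 0 <= K x by rewrite !mulr_ge0 ?expR_ge0.
(* Pointwise [u v <= t u^2 / 2 + v^2 / (2 t)], where [u] and [v] are [f p] and [g q] times the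
   square roots of their Gaussian weights. *)
have KAB p q : K (p, q) <= A (p, q) + B (p, q).
  rewrite /K /A /B /G /fock_kernel /f2 /g2 /= -[- nsq p]/(- nsq p).
  set ep := expR (- nsq p / 2); set eq := expR (- nsq q / 2).
  have ep2 : expR (- nsq p) = ep ^+ 2.
    by rewrite /ep expr2 -expRD; congr expR; field.
  have eq2 : expR (- nsq q) = eq ^+ 2.
    by rewrite /eq expr2 -expRD; congr expR; field.
  rewrite ep2 eq2 !expRD -!mulNr -/ep -/eq.
  set X := expR (- b * _).
  have X0 : 0 <= X by exact: expR_ge0.
  rewrite -subr_ge0.
  have -> : t / 2 * (f p ^+ 2 * ep ^+ 2) * X + t^-1 / 2 * (g q ^+ 2 * eq ^+ 2) * X -
     f p * g q * (X * ep * eq) = X / (2 * t) * (t * (f p * ep) - g q * eq) ^+ 2.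
    by field; rewrite gt_eqF.
  by rewrite mulr_ge0 ?sqr_ge0// divr_ge0// mulr_ge0// ltW.
apply: (@le_trans _ _ (\int[lam2]_p (\int[lam2]_q (A (p, q))%:E +
    \int[lam2]_q (B (p, q))%:E))%E).
  apply: ge0_le_integral => //.
  - by move=> p _; apply: integral_ge0 => q _; exact: (K0 (p, q)).
  - exact: (measurable_inner K mK K0).
  - apply: emeasurable_funD; first exact: (measurable_inner A mA A0).
    exact: (measurable_inner B mB B0).
  move=> p _; rewrite -ge0_integralD//; first last.
  - exact: (measurable_section B).
  - by move=> q _; exact: (B0 (p, q)).
  - exact: (measurable_section A).
  - by move=> q _; exact: (A0 (p, q)).
  apply: ge0_le_integral => //.
  - by move=> q _; exact: (K0 (p, q)).
  - exact: (measurable_section K).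
  - apply: emeasurable_funD; first exact: (measurable_section A).
    exact: (measurable_section B).
  by move=> q _; rewrite -EFinD lee_fin KAB.
rewrite ge0_integralD//; first last.
- exact: (measurable_inner B mB B0).
- by move=> p _; apply: integral_ge0 => q _; exact: (B0 (p, q)).
- exact: (measurable_inner A mA A0).
- by move=> p _; apply: integral_ge0 => q _; exact: (A0 (p, q)).
have -> : (\int[lam2]_p \int[lam2]_q (A (p, q))%:E =
    (pi / b)%:E * \int[lam2]_p (f2 p)%:E)%E 
  by exact: (double_integral_gauss b f2 b0 mf2 f20).
have -> : (\int[lam2]_p \int[lam2]_q (B (p, q))%:E =
    (pi / b)%:E * \int[lam2]_p (g2 p)%:E)%E.
  rewrite (double_integral_swap B mB B0) -(double_integral_gauss b g2 b0 mg2 g20).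
  apply: eq_integral => p _; apply: eq_integral => q _.
  by rewrite /B /G /=; congr (_ * expR (_ * _))%:E; rewrite /nsq /=; ring.
have mE h : measurable_fun setT h ->
    measurable_fun setT (fun p => (h p ^+ 2 * expR (- nsq p))%:E).
  move=> mh; apply/measurable_EFinP; apply: measurable_funM => //.
  exact: measurable_funX.
have E0 h p : (0 <= (h p ^+ 2 * expR (- nsq p))%:E)%E.
  by rewrite lee_fin mulr_ge0 ?sqr_ge0 ?expR_ge0.
have t20 : 0 <= t / 2 by rewrite divr_ge0// ltW.
have t'20 : 0 <= t^-1 / 2 by rewrite divr_ge0// invr_ge0 ltW.
under [X in (_ * X + _ <= _)%E]eq_integral do rewrite /f2 EFinM.
under [X in (_ + _ * X <= _)%E]eq_integral do rewrite /g2 EFinM.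
rewrite !ge0_integralZl ?lee_fin//; [|exact: mE|exact: mE].
set If := (\int[lam2]_p (f p ^+ 2 * expR (- nsq p))%:E)%E.
set Ig := (\int[lam2]_p (g p ^+ 2 * expR (- nsq p))%:E)%E.
have If0 : (0 <= If)%E by apply: integral_ge0.
have Ig0 : (0 <= Ig)%E by apply: integral_ge0.
have Jf0 : (0 <= t%:E * If)%E by rewrite mule_ge0// lee_fin ltW.
have Jg0 : (0 <= t^-1%:E * Ig)%E by rewrite mule_ge0// lee_fin invr_ge0 ltW.
rewrite (ge0_muleDr _ Jf0 Jg0).
rewrite !muleA -!EFinM.
have -> : pi / b * (t / 2) = pi / (2 * b) * t by field; rewrite gt_eqF.
have -> : pi / b * (t^-1 / 2) = pi / (2 * b) * t^-1.
  by field; rewrite gt_eqF// gt_eqF.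
exact: lexx.
Qed.

End DoubleIntegrals.

(** * From the negative part to the positive part *)

Section NegativePart.
Context {R : realType}.
Local Open Scope complex_scope.
Implicit Types (F f g h rho : R * R -> R) (p q : R * R) (Q : {poly R[i]}).

Notation nc := Normc.normc.

Definition scl (c : R) p : R * R := (c * p.1, c * p.2).

Lemma nsq_scl c p : nsq (scl c p) = c ^+ 2 * nsq p.
Proof. by rewrite /nsq /= !exprMn mulrDr. Qed.

Lemma cpt_scl c p : cpt (scl c p) = c%:C * cpt p.
Proof. by apply/eqP; rewrite eq_complex /= !mul0r subr0 addr0 !eqxx. Qed.

Lemma horner_scl c Q p : Q.[cpt (scl c p)] = (Q \Po (c%:C *: 'X)).[cpt p].
Proof. by rewrite horner_comp !hornerE cpt_scl. Qed.

Lemma gdecay_gauss_center (a : R) c : 0 < a ->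
  gdecay (fun p => expR (- a * nsq (p - c))).
Proof.
move=> a0; split.
  apply: measurableT_comp => //; apply: measurable_funM => //.
  by apply: measurable_funD; apply: measurable_funX; exact: measurable_funB.
exists (expR (a * nsq c)), (a / 2); split; first by rewrite divr_gt0.
move=> p; rewrite ger0_norm ?expR_ge0// -expRD ler_expR -subr_ge0.
rewrite (_ : _ - _ = a / 2 * nsq (p - (c + c))); last by rewrite /nsq /=; field.
by rewrite mulr_ge0 ?nsq_ge0// divr_ge0// ltW.
Qed.

Definition posp Q p := Num.max (complex.Re Q.[cpt p]) 0.
Definition negp Q p := Num.max (- complex.Re Q.[cpt p]) 0.

Lemma subgauss_posp Q : subgauss (posp Q).
Proof. exact: subgauss_max (subgauss_Re Q) (subgauss_cst 0). Qed.

Lemma subgauss_negp Q : subgauss (negp Q).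
Proof. exact: subgauss_max (subgaussN _ (subgauss_Re Q)) (subgauss_cst 0). Qed.

Lemma posp_ge0 Q p : 0 <= posp Q p. Proof. by rewrite le_max lexx orbT. Qed.

Lemma negp_ge0 Q p : 0 <= negp Q p. Proof. by rewrite le_max lexx orbT. Qed.

Lemma negpE Q p : negp Q p = posp Q p - complex.Re Q.[cpt p].
Proof.
rewrite /negp /posp; set x := complex.Re _.
by have [x0|x0] := leP 0 x;
  [rewrite max_r ?oppr_le0// subrr|rewrite max_l ?oppr_ge0 ?sub0r// ltW].
Qed.

Lemma negp_le_normc Q p : negp Q p <= nc Q.[cpt p].
Proof.
by rewrite ge_max normc_ge0 andbT (le_trans _ (normr_Re_le_normc _))// -normrN ler_norm.
Qed.

Lemma gdecay_sqr f : subgauss f -> gdecay (fun p => f p ^+ 2 * expR (- nsq p)).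
Proof.
move=> sf; apply: subgauss_gdecay; first exact: subgaussX.
by under eq_fun do rewrite -mulN1r; exact: gdecay_gauss.
Qed.

(** The integrand of the error left by trading [negp] for [posp]: the real part is taken at the
    contracted point [th w], with [th = b / (b + 1/2)]. *)
Definition low_term (b : R) Q p :=
  nc Q.[cpt p] * (`|complex.Re Q.[cpt (scl (b / (b + 2^-1)) p)]| *
    expR (- ((1 + b / (b + 2^-1)) / 2) * nsq p)).

(** Completing the square in [p] turns the kernel into a Gaussian of rate [b + 1/2] centred at
    [th q], times a factor depending on [q] alone. *)
Lemma mean_value_fock Q (b : R) q : 0 < b ->
  \int[lam2]_p (complex.Re Q.[cpt p] * fock_kernel b p q) =
  pi / (b + 2^-1) * (complex.Re Q.[cpt (scl (b / (b + 2^-1)) q)] *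
    expR (- ((1 + b / (b + 2^-1)) / 2) * nsq q)).
Proof.
move=> b0; set a := b + 2^-1; set th := b / a.
have a0 : 0 < a by rewrite addr_gt0// invr_gt0.
rewrite mulrA -mean_value_gauss// -RintegralZr//; last first.
  apply: gdecay_integrable; apply: subgauss_gdecay (subgauss_Re _) _.
  exact: gdecay_gauss_center.
apply: eq_Rintegral => p _; rewrite -mulrA -expRD; congr (_ * expR _).
rewrite /th /a /nsq /scl /=; field.
by rewrite gt_eqF//; lra.
Qed.


Lemma gdecay_low_term (b : R) Q : 0 < b -> gdecay (low_term b Q).
Proof.
move=> b0; apply: subgauss_gdecay (subgauss_normc _) _.
apply: subgauss_gdecay.
  apply: subgauss_norm; under eq_fun do rewrite horner_scl; exact: subgauss_Re.
by apply: gdecay_gauss; rewrite divr_gt0// addr_gt0// divr_gt0// addr_gt0// invr_gt0.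
Qed.

(** Since [negp] is [posp] minus the real part, only the integral of the real part has to be
    evaluated, and [mean_value_fock] does so. *)
Lemma integral_negp_kernel_le Q (b : R) q : 0 < b ->
  \int[lam2]_p (negp Q p * fock_kernel b p q) <=
  \int[lam2]_p (posp Q p * fock_kernel b p q) + pi / (b + 2^-1) *
    (`|complex.Re Q.[cpt (scl (b / (b + 2^-1)) q)]| *
    expR (- ((1 + b / (b + 2^-1)) / 2) * nsq q)).
Proof.
move=> b0.
have dK f : subgauss f ->
    lam2.-integrable setT (EFin \o (fun p => f p * fock_kernel b p q)).
  move=> sf; apply: gdecay_integrable; apply: subgauss_gdecay sf _.
  by under eq_fun do rewrite fock_kernelC; exact: gdecay_fock_kernel.
under eq_Rintegral do rewrite negpE mulrBl.
rewrite RintegralB//; last 2 first.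
- by apply: dK; exact: subgauss_posp.
- by apply: dK; exact: subgauss_Re.
rewrite mean_value_fock// lerD2l -mulrN -mulNr.
rewrite ler_wpM2l ?divr_ge0 ?pi_ge0 ?addr_ge0 ?invr_ge0 ?(ltW b0)//.
by rewrite ler_wpM2r ?expR_ge0// -normrN ler_norm.
Qed.

Lemma negp_sqr_le Q (b t : R) : 0 < b -> 0 < t ->
  \int[lam2]_p (negp Q p ^+ 2 * expR (- nsq p)) <=
  2 * (b + 2^-1) / pi * (pi / (2 * b) *
    (t * \int[lam2]_p (posp Q p ^+ 2 * expR (- nsq p)) +
     t^-1 * \int[lam2]_p (nc Q.[cpt p] ^+ 2 * expR (- nsq p))) +
    pi / (b + 2^-1) * \int[lam2]_p low_term b Q p).
Proof.
move=> b0 t0; set a := b + 2^-1.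
have a0 : 0 < a by rewrite addr_gt0// invr_gt0.
have pi0 : 0 < pi :> R := pi_gt0 R.
have c0 : 0 <= 2 * a / pi by rewrite divr_ge0 ?mulr_ge0 ?(ltW a0) ?(ltW pi0).
pose N (x : (R * R) * (R * R)) := negp Q x.1 * nc Q.[cpt x.2] * fock_kernel b x.1 x.2.
pose P (x : (R * R) * (R * R)) := posp Q x.1 * nc Q.[cpt x.2] * fock_kernel b x.1 x.2.
have [mn _] := subgauss_negp Q.
have [mp _] := subgauss_posp Q.
have [mc _] := subgauss_normc Q.
have mN : measurable_fun setT N.
  apply: measurable_funM; last exact: measurable_fock_kernel.
  apply: measurable_funM; first exact: (measurableT_comp mn).
  exact: (measurableT_comp mc).
have mP : measurable_fun setT P.
  apply: measurable_funM; last exact: measurable_fock_kernel.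
  apply: measurable_funM; first exact: (measurableT_comp mp).
  exact: (measurableT_comp mc).
have N0 x : 0 <= N x by rewrite !mulr_ge0 ?expR_ge0 ?negp_ge0 ?normc_ge0.
have P0 x : 0 <= P x by rewrite !mulr_ge0 ?expR_ge0 ?posp_ge0 ?normc_ge0.
have dlow := gdecay_low_term b Q b0.
have mlow : measurable_fun setT (EFin \o low_term b Q).
  by apply/measurable_EFinP; case: dlow.
have low0 p : 0 <= low_term b Q p.
  by rewrite !mulr_ge0 ?expR_ge0 ?normc_ge0.
have dK f q : subgauss f -> gdecay (fun p => f p * fock_kernel b p q).
  move=> sf; apply: subgauss_gdecay sf _.
  by under eq_fun do rewrite fock_kernelC; exact: gdecay_fock_kernel.
rewrite -lee_fin -gdecay_integral; last exact/gdecay_sqr/subgauss_negp.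
(* One of the two factors [negp] is bounded by the modulus of [Q], to which the sub-mean value
   inequality applies. *)
apply: (@le_trans _ _ ((2 * a / pi)%:E * \int[lam2]_p \int[lam2]_q (N (p, q))%:E)%E).
  rewrite -ge0_integralZl ?lee_fin//; last 2 first.
  - exact: (measurable_inner N mN N0).
  - by move=> p _; apply: integral_ge0 => q _; exact: (N0 (p, q)).
  apply: ge0_le_integral => //.
  - by move=> p _; rewrite lee_fin mulr_ge0 ?sqr_ge0 ?expR_ge0.
  - by apply/measurable_EFinP; case: (gdecay_sqr _ (subgauss_negp Q)).
  - by apply: measurable_funeM; exact: (measurable_inner N mN N0).
  move=> p _.
  have -> : (\int[lam2]_q (N (p, q))%:E)%E =
      (negp Q p * \int[lam2]_q (nc Q.[cpt q] * fock_kernel b p q))%:E.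
    have dc : gdecay (fun q => nc Q.[cpt q] * fock_kernel b p q).
      exact: subgauss_gdecay (subgauss_normc _) (gdecay_fock_kernel _ _ b0).
    rewrite -RintegralZl//; last exact: gdecay_integrable.
    rewrite -gdecay_integral; last exact: subgauss_gdecay (subgauss_cst _) dc.
    by apply: eq_integral => q _; rewrite /N /= mulrA.
  rewrite -EFinM lee_fin mulrCA expr2 -mulrA ler_wpM2l ?negp_ge0//.
  apply: le_trans (sub_mean_value_fock Q b p b0).
  by rewrite ler_wpM2r ?expR_ge0 ?negp_le_normc.
rewrite [leRHS]EFinM lee_wpmul2l ?lee_fin//.
(* Now the inner integral runs over the variable of [negp], where [integral_negp_kernel_le] can be
   used. *)
rewrite (double_integral_swap N mN N0).
have d1 := gdecay_sqr _ (subgauss_posp Q).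
have d2 := gdecay_sqr _ (subgauss_normc Q).
(* The [posp] term is swapped back and bounded by the Young-type inequality with weight [t]. *)
apply: (@le_trans _ _ (\int[lam2]_q \int[lam2]_p (P (p, q))%:E +
    (pi / a)%:E * \int[lam2]_q (low_term b Q q)%:E)%E); last first.
  rewrite EFinD gdecay_integral// -EFinM leeD2r// -(double_integral_swap P mP P0).
  apply: le_trans (double_integral_fock_le b t _ _ b0 t0 mp (posp_ge0 Q) mc _) _.
    by move=> p; exact: normc_ge0.
  by rewrite !gdecay_integral.
have pa0 : 0 <= pi / a by rewrite divr_ge0 ?ltW.
have mswap (A : (R * R) * (R * R) -> R) : measurable_fun setT A -> (forall x, 0 <= A x) ->
  measurable_fun setT (fun q => \int[lam2]_p (A (p, q))%:E)%E.
  move=> mA A0.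
  apply: (measurable_inner (A \o (fun x => (x.2, x.1)))) => [|x]; last exact: A0.
  by apply: (measurableT_comp mA); exact: measurable_fun_pair.
rewrite -ge0_integralZl ?lee_fin//; last by move=> q _; rewrite lee_fin.
rewrite -ge0_integralD//; first last.
- exact: measurable_funeM.
- by move=> q _; rewrite -EFinM lee_fin mulr_ge0.
- exact: mswap.
- by move=> q _; apply: integral_ge0 => p _; exact: (P0 (p, q)).
apply: ge0_le_integral => //.
- by move=> q _; apply: integral_ge0 => p _; exact: (N0 (p, q)).
- exact: mswap.
- by apply: emeasurable_funD; [exact: mswap|exact: measurable_funeM].
move=> q _.
have E f : subgauss f -> (\int[lam2]_p (f p * nc Q.[cpt q] * fock_kernel b p q)%:E)%E =
    (nc Q.[cpt q] * \int[lam2]_p (f p * fock_kernel b p q))%:E.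
  move=> sf; rewrite -RintegralZl//; last exact/gdecay_integrable/dK.
  rewrite -gdecay_integral; last exact: subgauss_gdecay (subgauss_cst _) (dK _ _ sf).
  by apply: eq_integral => p _; rewrite mulrA [nc _ * _]mulrC.
rewrite /N /P /= !E; [|exact: subgauss_posp|exact: subgauss_negp].
rewrite -EFinM -EFinD lee_fin /low_term mulrCA -mulrDr ler_wpM2l ?normc_ge0//.
exact: integral_negp_kernel_le.
Qed.

End NegativePart.

(** * The Gaussian-weighted integral *)

Section OneSided.
Context {R : realType}.
Local Open Scope complex_scope.
Implicit Types (F f g h rho : R * R -> R) (p q : R * R) (Q : {poly R[i]}).

Notation nc := Normc.normc.

Lemma quadratic_ge0_discr (A B C : R) : 0 <= C ->
  (forall x, 0 <= A - 2 * x * B + x ^+ 2 * C) -> B ^+ 2 <= A * C.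
Proof.
rewrite le_eqVlt => /orP[/eqP <- H|C0 H].
  rewrite mulr0; have [->|B0] := eqVneq B 0; first by rewrite expr0n.
  (* In the degenerate case this [x] gives the expression the value -1. *)
  have := H ((A + 1) / (2 * B)).
  have -> : 2 * ((A + 1) / (2 * B)) * B = A + 1 by field.
  by rewrite mulr0 addr0; lra.
have := H (B / C).
have -> : A - 2 * (B / C) * B + (B / C) ^+ 2 * C = (A * C - B ^+ 2) / C.
  by field; rewrite gt_eqF.
by rewrite pmulr_lge0 ?invr_gt0// subr_ge0.
Qed.

(** Integration against the Fock weight without the factor 1/pi: the squared Fock norm of F is
    [gint] of |F|^2, divided by [pi]. *)
Definition gint h : R := \int[lam2]_p (h p * expR (- nsq p)).

Lemma gdecay_gint h : subgauss h -> gdecay (fun p => h p * expR (- nsq p)).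
Proof.
move=> sh; apply: subgauss_gdecay => //.
by under eq_fun do rewrite -mulN1r; exact: gdecay_gauss.
Qed.

Lemma gintD f g : subgauss f -> subgauss g ->
  gint (fun p => f p + g p) = gint f + gint g.
Proof.
move=> sf sg; rewrite /gint -RintegralD//; last 2 first.
- exact/gdecay_integrable/gdecay_gint.
- exact/gdecay_integrable/gdecay_gint.
by apply: eq_Rintegral => p _; rewrite mulrDl.
Qed.

Lemma gintZ (c : R) f : subgauss f -> gint (fun p => c * f p) = c * gint f.
Proof.
move=> sf; rewrite /gint -RintegralZl//; last exact/gdecay_integrable/gdecay_gint.
by apply: eq_Rintegral => p _; rewrite mulrA.
Qed.

Lemma le_gint f g : subgauss f -> subgauss g -> (forall p, f p <= g p) ->
  gint f <= gint g.
Proof.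
move=> sf sg fg; apply: le_Rintegral => //.
- exact/gdecay_integrable/gdecay_gint.
- exact/gdecay_integrable/gdecay_gint.
by move=> p _; rewrite ler_wpM2r ?expR_ge0.
Qed.

Lemma gint_ge0 f : (forall p, 0 <= f p) -> 0 <= gint f.
Proof.
by move=> f0; apply: Rintegral_ge0 => p _; rewrite mulr_ge0 ?expR_ge0.
Qed.

Lemma eq_gint f g : f =1 g -> gint f = gint g.
Proof. by move=> /funext ->. Qed.

Lemma Rintegral_gauss (a : R) : 0 < a -> \int[lam2]_p expR (- a * nsq p) = pi / a.
Proof. by move=> a0; rewrite /Rintegral integral_gauss_plane. Qed.

Lemma gint_cst (c : R) : gint (fun=> c) = c * pi.
Proof.
rewrite (eq_gint _ (fun=> c * 1)); last by move=> p; rewrite mulr1.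
rewrite gintZ; last exact: subgauss_cst.
rewrite /gint (_ : \int[lam2]_p _ = \int[lam2]_p expR (- 1 * nsq p)).
  by rewrite Rintegral_gauss// divr1.
by apply: eq_Rintegral => p _; rewrite mul1r mulN1r.
Qed.

Lemma gint_CauchySchwarz f g : subgauss f -> subgauss g ->
  gint (fun p => f p * g p) ^+ 2 <=
  gint (fun p => f p ^+ 2) * gint (fun p => g p ^+ 2).
Proof.
move=> sf sg; apply: quadratic_ge0_discr.
  by apply: gint_ge0 => p; exact: sqr_ge0.
move=> x.
have sfg := subgaussM _ _ sf sg.
have -> : gint (fun p => f p ^+ 2) - 2 * x * gint (fun p => f p * g p) +
    x ^+ 2 * gint (fun p => g p ^+ 2) = gint (fun p => (f p - x * g p) ^+ 2).
  have sf2 := subgaussX _ 2 sf; have sg2 := subgaussX _ 2 sg.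
  rewrite -mulNr -!gintZ//.
  have s3 := subgaussM _ _ (subgauss_cst (- (2 * x))) sfg.
  have s4 := subgaussM _ _ (subgauss_cst (x ^+ 2)) sg2.
  have s5 := subgaussD _ _ sf2 s3.
  by rewrite -!gintD//; apply: eq_gint => p; ring.
by apply: gint_ge0 => p; exact: sqr_ge0.
Qed.

Lemma radial_gauss h : radial h -> radial (fun p => h p * expR (- nsq p)).
Proof. by move=> rh p q pq; rewrite (rh _ _ pq) pq. Qed.

Lemma gint_mean_value Q h : subgauss h -> radial h ->
  gint (fun p => complex.Re Q.[cpt p] * h p) = complex.Re Q.[0] * gint h.
Proof.
move=> sh rh; rewrite -mean_value_radial; [|exact: gdecay_gint|exact: radial_gauss].
by apply: eq_Rintegral => p _; rewrite mulrA.
Qed.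

(** From (Re Q)^2 = (|Q|^2 + Re Q^2) / 2, where the last term has mean zero because Q^2 vanishes at
    0. *)
Lemma gint_Re_sqr Q : Q.[0] = 0 ->
  gint (fun p => complex.Re Q.[cpt p] ^+ 2) = gint (fun p => nc Q.[cpt p] ^+ 2) / 2.
Proof.
move=> Q0.
have s1 := subgaussX _ 2 (subgauss_normc Q).
have mv : gint (fun p => complex.Re (Q * Q).[cpt p]) = 0.
  rewrite (eq_gint _ (fun p => complex.Re (Q * Q).[cpt p] * 1)); last first.
    by move=> p; rewrite mulr1.
  rewrite gint_mean_value; [|exact: subgauss_cst|by []].
  by rewrite hornerM Q0 mul0r mul0r.
have -> : gint (fun p => complex.Re Q.[cpt p] ^+ 2) =
    gint (fun p => 2^-1 * nc Q.[cpt p] ^+ 2 + 2^-1 * complex.Re (Q * Q).[cpt p]).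
  by apply: eq_gint => p; rewrite hornerM Re_mul normc_sqr; field.
rewrite gintD; last 2 first.
- exact: subgaussM (subgauss_cst _) s1.
- exact: subgaussM (subgauss_cst _) (subgauss_Re _).
rewrite !gintZ//; last exact: subgauss_Re.
by rewrite mv mulr0 addr0 mulrC.
Qed.

Lemma normc_sqrD (x y : R[i]) :
  nc (x + y) ^+ 2 = nc x ^+ 2 + nc y ^+ 2 + 2 * complex.Re (x^* * y).
Proof.
by rewrite !normc_sqr Re_mul Re_add Im_add; case: x => a b; case: y => c d /=; ring.
Qed.

(** The cross term is the real part of a polynomial vanishing at 0. The factor [nsq p] moves into
    the weight, so that the coefficients of a polynomial can be peeled off one at a time. *)
Lemma gint_radial_pythagoras (c : R[i]) Q h : subgauss h -> radial h ->
  gint (fun p => nc (c + cpt p * Q.[cpt p]) ^+ 2 * h p) =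
  nc c ^+ 2 * gint h + gint (fun p => nc Q.[cpt p] ^+ 2 * (nsq p * h p)).
Proof.
move=> sh rh.
have sc := subgaussM _ _ (subgauss_cst (nc c ^+ 2)) sh.
have sQ : subgauss (fun p => nc Q.[cpt p] ^+ 2 * (nsq p * h p)).
  by apply: subgaussM (subgaussM _ _ subgauss_nsq sh); apply/subgaussX/subgauss_normc.
have sX : subgauss (fun p => complex.Re (c^*%:P * ('X * Q)).[cpt p] * h p).
  by apply: subgaussM => //; exact: subgauss_Re.
transitivity (gint (fun p => (nc c ^+ 2 * h p + nc Q.[cpt p] ^+ 2 * (nsq p * h p)) +
    2 * (complex.Re (c^*%:P * ('X * Q)).[cpt p] * h p))).
  apply: eq_gint => p; rewrite normc_sqrD hornerCM hornerM hornerX.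
  by rewrite Normc.normcM exprMn normc_cpt; ring.
rewrite gintD; [|exact: subgaussD|exact: subgaussM (subgauss_cst _) sX].
rewrite gintD// !gintZ// gint_mean_value//.
by rewrite hornerCM hornerM hornerX mul0r mulr0 mul0r mulr0 addr0.
Qed.

(** Each coefficient peeled off leaves a further factor [c ^+ 2 <= 1] on the remainder. The weight
    [h] varies in the induction, since it picks up [nsq] at each step. *)
Lemma gint_contraction (c : R) Q h : 0 <= c <= 1 -> subgauss h -> radial h ->
  (forall p, 0 <= h p) ->
  gint (fun p => nc Q.[cpt (scl c p)] ^+ 2 * h p) <=
  gint (fun p => nc Q.[cpt p] ^+ 2 * h p).
Proof.
move=> /andP[c0 c1]; elim/poly_ind: Q h => [|Q k IH] h sh rh h0.
  by rewrite (eq_gint _ (fun p => nc (0 : {poly R[i]}).[cpt p] ^+ 2 * h p)) // => p;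
    rewrite !horner0.
have sn : subgauss (fun p => nsq p * h p) by exact: subgaussM subgauss_nsq sh.
have rn : radial (fun p => nsq p * h p) by move=> p q pq; rewrite (rh _ _ pq) pq.
have n0 p : 0 <= nsq p * h p by rewrite mulr_ge0 ?nsq_ge0.
have -> : gint (fun p => nc (Q * 'X + k%:P).[cpt p] ^+ 2 * h p) =
    nc k ^+ 2 * gint h + gint (fun p => nc Q.[cpt p] ^+ 2 * (nsq p * h p)).
  rewrite -gint_radial_pythagoras//; apply: eq_gint => p.
  by rewrite hornerMXaddC addrC mulrC [_.[_] * _]mulrC mulrC.
have -> : gint (fun p => nc (Q * 'X + k%:P).[cpt (scl c p)] ^+ 2 * h p) =
    nc k ^+ 2 * gint h +
    c ^+ 2 * gint (fun p => nc Q.[cpt (scl c p)] ^+ 2 * (nsq p * h p)).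
  rewrite -gintZ; last first.
    apply: subgaussM => //; apply: subgaussX.
    by under eq_fun do rewrite horner_scl; exact: subgauss_normc.
  transitivity (gint (fun p =>
      nc (k + cpt p * (c%:C *: (Q \Po (c%:C *: 'X))).[cpt p]) ^+ 2 * h p)).
    apply: eq_gint => p; rewrite hornerMXaddC addrC cpt_scl hornerZ -horner_scl.
    by rewrite -cpt_scl; congr (nc (_ + _) ^+ 2 * _); rewrite cpt_scl; ring.
  rewrite gint_radial_pythagoras//; congr (_ + _); apply: eq_gint => p.
  rewrite hornerZ -horner_scl Normc.normcM exprMn -mulrA; congr (_ * _).
  by rewrite normc_sqr /= expr0n addr0.
rewrite lerD2l (le_trans _ (IH _ sn rn n0))// ler_piMl ?expr_le1//.
by apply: gint_ge0 => p; rewrite mulr_ge0 ?sqr_ge0.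
Qed.

End OneSided.

(** * The one-sided estimate *)

Section Main.
Context {R : realType}.
Local Open Scope complex_scope.
Implicit Types (F f g h rho : R * R -> R) (p q : R * R) (Q : {poly R[i]}).

Notation nc := Normc.normc.

Lemma Rintegral_dilation F (c : R) : gdecay F -> (forall p, 0 <= F p) -> 0 < c ->
  \int[lam2]_p F (scl c p) = c ^- 2 * \int[lam2]_p F p.
Proof.
move=> dF F0 c0; rewrite /Rintegral.
rewrite (ge0_plane_dilation (fun p => (F p)%:E))//; last first.
  by apply/measurable_EFinP; case: dF.
by rewrite gdecay_integral.
Qed.

(** Half of the exact value suffices, and follows from 1 - exp(-u) <= u. *)
Lemma nsq_gint_ge : pi / 2 <= gint (@nsq R).
Proof.
have g1 : gdecay (fun p : R * R => expR (- 1 * nsq p)) by exact: gdecay_gauss.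
have g2 : gdecay (fun p : R * R => expR (- 2 * nsq p)) by exact: gdecay_gauss.
have -> : pi / 2 = \int[lam2]_(p in [set: R * R])
    (expR (- 1 * nsq p) - expR (- 2 * nsq p)).
  rewrite RintegralB//; [|exact: gdecay_integrable..].
  by rewrite !Rintegral_gauss//; field.
apply: le_Rintegral => //.
- apply: gdecay_integrable.
  have := gdecayD _ _ g1 (subgauss_gdecay _ _ (subgauss_cst (-1)) g2).
  by under eq_fun do rewrite [-1 * expR _]mulN1r.
- exact/gdecay_integrable/gdecay_gint/subgauss_nsq.
move=> p _; have -> : - 2 * nsq p = - nsq p + - nsq p by ring.
rewrite expRD mulN1r -[X in X - _]mul1r -mulrBl ler_wpM2r ?expR_ge0//.
by have := expR_ge1Dx (- nsq p); lra.
Qed.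

(** A crude bound, from u <= exp(u) at u = |z|^2 / 4. *)
Lemma nsq_sqr_gint_le : gint (fun p : R * R => nsq p ^+ 2) <= 32 * pi.
Proof.
have h0 : (0 : R) < 2^-1 by rewrite invr_gt0.
have g1 : gdecay (fun p : R * R => 16 * expR (- 2^-1 * nsq p)).
  by apply: subgauss_gdecay (subgauss_cst _) _; exact: gdecay_gauss.
have -> : 32 * pi = \int[lam2]_(p in [set: R * R]) (16 * expR (- 2^-1 * nsq p)).
  rewrite RintegralZl//; last exact/gdecay_integrable/gdecay_gauss.
  by rewrite Rintegral_gauss//; field.
apply: le_Rintegral => //.
- exact/gdecay_integrable/gdecay_gint/subgaussX/subgauss_nsq.
- exact: gdecay_integrable.
move=> p _.
have -> : - 2^-1 * nsq p = nsq p / 4 + nsq p / 4 + - nsq p by field.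
rewrite !expRD mulrA ler_wpM2r ?expR_ge0// -expr2.
have e1 : nsq p / 4 <= expR (nsq p / 4).
  by rewrite (le_trans _ (expR_ge1Dx _))// lerDr.
have n0 : 0 <= nsq p / 4 by rewrite divr_ge0 ?nsq_ge0.
have -> : nsq p ^+ 2 = 16 * (nsq p / 4) ^+ 2 by field.
by rewrite ler_wpM2l// lerXn2r ?nnegrE ?expR_ge0.
Qed.

(* The first Taylor coefficient is read off by the nonnegative test function
   [|1 + g z| ^ 2] with [g] a phase. *)
Lemma first_coef_le (k : R[i]) Q :
  nc k ^+ 2 * gint (@nsq R) <=
  528 * gint (fun p => posp ((Q * 'X + k%:P) * 'X) p ^+ 2).
Proof.
set P := (Q * 'X + k%:P) * 'X; set H := gint (fun p => posp P p ^+ 2).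
have H0 : 0 <= H by apply: gint_ge0 => p; exact: sqr_ge0.
have [g g1 gk] := exists_phase k.
set tau := gint nsq.
have taug := nsq_gint_ge; rewrite -/tau in taug.
have pi0 : 0 < pi :> R := pi_gt0 R.
pose T p : R := 1 + nsq p + 2 * complex.Re (g^* * cpt p).
have sl : subgauss (fun p => complex.Re (g^* * cpt p)).
  have := subgauss_Re (g^*%:P * 'X).
  by under eq_fun do rewrite hornerCM hornerX.
have sT : subgauss T.
  apply: subgaussD; first exact: subgaussD (subgauss_cst _) subgauss_nsq.
  exact: subgaussM (subgauss_cst _) sl.
have gJ : nc g^* ^+ 2 = 1.
  rewrite normc_sqr; move: (congr1 (fun x => x ^+ 2) g1).
  by rewrite normc_sqr expr1n; case: (g) => a b /=; rewrite sqrrN.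
have TE p : T p = nc (1 + g^* * cpt p) ^+ 2.
  rewrite normc_sqrD Normc.normc1 expr1n Normc.normcM exprMn gJ mul1r normc_cpt.
  by rewrite /T; case: (g^* * cpt p) => a b /=; ring.
have T0 p : 0 <= T p by rewrite TE sqr_ge0.
have s1 : subgauss (fun p => 1 + nsq p) by exact: subgaussD (subgauss_cst _) subgauss_nsq.
have r1 : radial (fun p => 1 + nsq p) by move=> p q ->.
have rn : radial (@nsq R) by move=> p q ->.
have P0 : P.[0] = 0 by rewrite hornerM hornerX mulr0.
(* The product 2 Re P Re(conj g z) is Re(conj g z P) + Re(g conj z P), and g conj z P = |z|^2 g (Q z
   + k). Only the last term survives the mean value property, through g k = |k|. *)
have e1 : gint (fun p => complex.Re P.[cpt p] * T p) = nc k * tau.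
  transitivity (gint (fun p => complex.Re P.[cpt p] * (1 + nsq p) +
     (complex.Re (g^*%:P * 'X * P).[cpt p] * 1 +
      complex.Re (g%:P * (Q * 'X + k%:P)).[cpt p] * nsq p))).
    apply: eq_gint => p; rewrite /T !hornerM !hornerC !hornerX -normc_cpt.
    set A := (Q * 'X + k%:P).[cpt p].
    rewrite normc_sqr !Re_mul !Im_mul.
    by case: (g) => a b; case: A => c d; case: (cpt p) => x y /=; ring.
  rewrite gintD; last 2 first.
  - exact: subgaussM (subgauss_Re _) s1.
  - apply: subgaussD; first exact: subgaussM (subgauss_Re _) (subgauss_cst _).
    exact: subgaussM (subgauss_Re _) subgauss_nsq.
  rewrite gintD; last 2 first.
  - exact: subgaussM (subgauss_Re _) (subgauss_cst _).
  - exact: subgaussM (subgauss_Re _) subgauss_nsq.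
  rewrite !gint_mean_value//; [|exact: subgauss_nsq|exact: subgauss_cst].
  rewrite P0 mul0r add0r hornerM P0 mulr0 mul0r add0r.
  by rewrite hornerM hornerMXaddC hornerC mulr0 add0r gk.
have e2 : gint (fun p => complex.Re P.[cpt p] * T p) <= gint (fun p => posp P p * T p).
  apply: le_gint.
  - exact: subgaussM (subgauss_Re _) sT.
  - exact: subgaussM (subgauss_posp _) sT.
  by move=> p; rewrite ler_wpM2r// le_max lexx.
have e3 := gint_CauchySchwarz _ _ (subgauss_posp P) sT.
(* By the parallelogram law [T <= 2 (1 + nsq)], so [T ^+ 2 <= 8 + 8 nsq ^+ 2], and 264 = 8 + 8 *
   32. *)
have e4 : gint (fun p => T p ^+ 2) <= 264 * pi.
  have s8 : subgauss (fun p : R * R => 8 + 8 * nsq p ^+ 2).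
    apply: subgaussD (subgauss_cst _) _.
    by apply: subgaussM (subgauss_cst _) _; exact: subgaussX subgauss_nsq.
  apply: (@le_trans _ _ (gint (fun p : R * R => 8 + 8 * nsq p ^+ 2))).
    apply: le_gint => //; first exact: subgaussX.
    move=> p; have Tn : T p <= 2 * (1 + nsq p).
      have -> : 2 * (1 + nsq p) = nc (1 - g^* * cpt p) ^+ 2 + T p.
        rewrite normc_sqrD normcN Normc.normcM exprMn gJ normc_cpt.
        by rewrite Normc.normc1 /T; case: (g^* * cpt p) => a b /=; ring.
      by rewrite lerDr sqr_ge0.
    have n0 := nsq_ge0 p.
    rewrite (@le_trans _ _ ((2 * (1 + nsq p)) ^+ 2))// ?lerXn2r ?nnegrE ?T0//.
      by rewrite mulr_ge0// addr_ge0.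
    by have := sqr_ge0 (1 - nsq p); nra.
  rewrite gintD; [|exact: subgauss_cst|]; last first.
    by apply: subgaussM (subgauss_cst _) _; exact: subgaussX subgauss_nsq.
  rewrite gintZ; last exact: subgaussX subgauss_nsq.
  rewrite gint_cst; have := nsq_sqr_gint_le; lra.
have e5 : (nc k * tau) ^+ 2 <= H * (264 * pi).
  rewrite -e1; apply: (@le_trans _ _ (gint (fun p => posp P p * T p) ^+ 2)).
    rewrite ler_pXn2r// nnegrE ?e1 ?mulr_ge0 ?normc_ge0//.
      by rewrite (le_trans _ taug)// divr_ge0// ltW.
    by apply: gint_ge0 => p; rewrite mulr_ge0// posp_ge0.
  by apply: (le_trans e3); rewrite ler_wpM2l.
(* One factor [tau] cancels, and [pi <= 2 * tau] doubles 264 to 528. *)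
have tau0 : 0 < tau by rewrite (lt_le_trans _ taug)// divr_gt0.
rewrite -(ler_pM2r tau0) -mulrA -expr2 -exprMn (le_trans e5)//.
have h : H * (pi / 2) <= H * tau by rewrite ler_wpM2l.
by rewrite -mulrA; lra.
Qed.

(* The constant comes from [b / (b + 1 / 2) = (1 / 8) ^ 2] for [b = 1 / 126]. *)
Lemma low_term_le (k : R[i]) Q (P := (Q * 'X + k%:P) * 'X) :
  2 * \int[lam2]_p low_term (126^-1) P p <=
  4^-1 * gint (fun p => nc P.[cpt p] ^+ 2) + 8 * (nc k ^+ 2 * gint (@nsq R)).
Proof.
set tau := gint nsq; set N := gint (fun p => nc P.[cpt p] ^+ 2).
have th : 126^-1 / (126^-1 + 2^-1) = 8^-1 ^+ 2 :> R by field.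
have c0 : (0 : R) < 8^-1 by rewrite invr_gt0.
(* The contraction by 1/64 is split into two by 1/8: one stays inside [F], the other is a change of
   variables that also restores the full Gaussian weight. *)
pose F p := nc P.[cpt (scl 8^-1 p)] ^+ 2 * expR (- nsq p).
have sP : subgauss (fun p => nc P.[cpt (scl 8^-1 p)]).
  by under eq_fun do rewrite horner_scl; exact: subgauss_normc.
have dF : gdecay F by apply: gdecay_gint; exact: subgaussX.
have F0 p : 0 <= F p by rewrite mulr_ge0 ?sqr_ge0 ?expR_ge0.
have rn : radial (@nsq R) by move=> p q ->.
have sn := @subgauss_nsq R.
(* The first coefficient is damped by 8^-2 and all higher ones by at least 8^-4. *)
have Fle : \int[lam2]_p F p <= 8^-1 ^+ 2 * (nc k ^+ 2 * tau + 8^-1 ^+ 2 * N).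
  have -> : \int[lam2]_p F p =
      8^-1 ^+ 2 * gint (fun p =>
        nc (k + cpt p * (8^-1%:C *: (Q \Po (8^-1%:C *: 'X))).[cpt p]) ^+ 2 * nsq p).
    rewrite -gintZ; last first.
      apply: subgaussM => //; apply: subgaussX.
      have := subgauss_normc (k%:P + 'X * (8^-1%:C *: (Q \Po (8^-1%:C *: 'X)))).
      by under eq_fun do rewrite hornerD hornerC hornerM hornerX.
    apply: eq_gint => p.
    rewrite /P hornerM hornerX hornerMXaddC addrC hornerZ -horner_scl.
    rewrite Normc.normcM exprMn normc_cpt nsq_scl.
    rewrite [X in _ = _ * (nc (_ + X) ^+ 2 * _)]
      (_ : _ = Q.[cpt (scl 8^-1 p)] * cpt (scl 8^-1 p)).
      by ring.
    by rewrite cpt_scl; ring.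
  rewrite gint_radial_pythagoras// ler_wpM2l ?sqr_ge0// lerD2l.
  have -> : N = nc k ^+ 2 * tau + gint (fun p => nc Q.[cpt p] ^+ 2 * (nsq p * nsq p)).
    rewrite -gint_radial_pythagoras//; apply: eq_gint => p.
    rewrite /P hornerM hornerX hornerMXaddC Normc.normcM exprMn normc_cpt addrC.
    by rewrite mulrC [_.[_] * _]mulrC mulrC.
  have nn0 p : 0 <= nsq p * nsq p :> R by rewrite mulr_ge0 ?nsq_ge0.
  have rnn : radial (fun p : R * R => nsq p * nsq p) by move=> p q ->.
  have c01 : 0 <= (8^-1 : R) <= 1 by rewrite (ltW c0) invf_le1// ler1n.
  have := gint_contraction 8^-1 Q _ c01 (subgaussM _ _ sn sn) rnn nn0.
  have -> : gint (fun p =>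
        nc (8^-1%:C *: (Q \Po (8^-1%:C *: 'X))).[cpt p] ^+ 2 * (nsq p * nsq p)) =
      8^-1 ^+ 2 * gint (fun p => nc Q.[cpt (scl 8^-1 p)] ^+ 2 * (nsq p * nsq p)).
    rewrite -gintZ; last first.
      apply: subgaussM (subgaussM _ _ sn sn); apply: subgaussX.
      by under eq_fun do rewrite horner_scl; exact: subgauss_normc.
    apply: eq_gint => p; rewrite hornerZ -horner_scl Normc.normcM exprMn -mulrA.
    by congr (_ * _); rewrite normc_sqr /= expr0n addr0.
  move=> le1; rewrite ler_wpM2l ?sqr_ge0// (le_trans le1)// lerDr.
  by rewrite mulr_ge0 ?sqr_ge0// (le_trans _ nsq_gint_ge)// divr_ge0 ?pi_ge0.
have Fscl : \int[lam2]_p F (scl 8^-1 p) = 8 ^+ 2 * \int[lam2]_p F p.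
  by rewrite (Rintegral_dilation _ _ dF F0 c0) exprVn invrK.
have dFs : gdecay (fun p => F (scl 8^-1 p)).
  rewrite /F; under eq_fun do rewrite nsq_scl -mulNr.
  apply: subgauss_gdecay; last by apply: gdecay_gauss; rewrite exprn_gt0.
  apply: subgaussX; under eq_fun do rewrite !horner_scl; exact: subgauss_normc.
have dN : gdecay (fun p => nc P.[cpt p] ^+ 2 * expR (- nsq p)).
  by apply: gdecay_gint; apply: subgaussX; exact: subgauss_normc.
have dZ (c : R) G : gdecay G -> gdecay (fun p => c * G p).
  by move=> dG; exact: subgauss_gdecay (subgauss_cst _) dG.
rewrite -RintegralZl//; last by apply/gdecay_integrable/gdecay_low_term; rewrite invr_gt0.
(* Uses 2 u v <= u^2 / 8 + 8 v^2. The dilation costs 8^2, so the second term contributes [N / 8] and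
   8 times the first-coefficient term. *)
apply: (@le_trans _ _ (\int[lam2]_p (8^-1 * (nc P.[cpt p] ^+ 2 * expR (- nsq p)) +
    8 * F (scl 8^-1 p)))).
  apply: le_Rintegral => //.
  - by apply/gdecay_integrable/dZ/gdecay_low_term; rewrite invr_gt0.
  - by apply/gdecay_integrable/gdecayD; exact: dZ.
  move=> p _; rewrite /low_term th /F.
  have -> : scl (8^-1) (scl 8^-1 p) = scl (8^-1 ^+ 2) p.
    by apply: injective_projections; rewrite /= mulrA expr2.
  set x := nc P.[cpt p]; set y := complex.Re _; set z := nc P.[cpt (scl _ p)].
  rewrite nsq_scl; set e := expR (- nsq p / 2).
  set d := expR (- (8^-1 ^+ 2 * nsq p) / 2).
  have -> : expR (- nsq p) = e ^+ 2 by rewrite /e expr2 -expRD; congr expR; field.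
  have -> : expR (- (8^-1 ^+ 2 * nsq p)) = d ^+ 2.
    by rewrite [RHS]expr2 /d -expRD; congr expR; field.
  have -> : expR (- ((1 + 8^-1 ^+ 2) / 2) * nsq p) = e * d.
    by rewrite /e /d -expRD; congr expR; field.
  have yz : `|y| <= z by exact: normr_Re_le_normc.
  have x0 : 0 <= x by exact: normc_ge0.
  have e0 : 0 <= e by exact: expR_ge0.
  have d0 : 0 <= d by exact: expR_ge0.
  apply: (@le_trans _ _ (2 * ((x * e) * (z * d)))).
    rewrite ler_wpM2l// -!mulrA ler_wpM2l// mulrCA ler_wpM2l//.
    by rewrite ler_wpM2r.
  rewrite -subr_ge0.
  have -> : 8^-1 * (x ^+ 2 * e ^+ 2) + 8 * (z ^+ 2 * d ^+ 2) - 2 * (x * e * (z * d))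
    = 8^-1 * (x * e - 8 * (z * d)) ^+ 2 by field.
  by rewrite mulr_ge0 ?sqr_ge0// ltW.
rewrite RintegralD//; last 2 first.
- exact/gdecay_integrable/dZ.
- exact/gdecay_integrable/dZ.
rewrite !RintegralZl//; [|exact: gdecay_integrable..].
rewrite Fscl -/N -/(gint _) -/N; move: Fle; lra.
Qed.

(* With the weight [8 ^+ 3] in [negp_sqr_le], three quarters of the left-hand
   side are absorbed. *)
Lemma one_sided_bound P : P.[0] = 0 ->
  gint (fun p => nc P.[cpt p] ^+ 2) <= 3 * 10 ^+ 5 * gint (fun p => posp P p ^+ 2).
Proof.
move=> P0.
(* Two roots are divided out to expose the first Taylor coefficient [P1.[0]]. *)
have [P1 PE1] : exists P1, P = P1 * 'X.
  by case/factor_theorem: (introT rootP P0) => P1; rewrite subr0; exists P1.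
have [Q PE2] : exists Q, P1 = Q * 'X + (P1.[0])%:P.
  have /factor_theorem[Q] : root (P1 - (P1.[0])%:P) 0.
    by rewrite /root hornerD hornerN hornerC subrr.
  by rewrite subr0 => /eqP; rewrite subr_eq => /eqP; exists Q.
have PE : P = (Q * 'X + (P1.[0])%:P) * 'X by rewrite -PE2.
have low := low_term_le P1.[0] Q; rewrite -PE in low.
have fc := first_coef_le P1.[0] Q; rewrite -PE in fc.
have b0 : (0 : R) < 126^-1 by rewrite invr_gt0.
have t0 : (0 : R) < 8 ^+ 3 by rewrite exprn_gt0.
have neg := negp_sqr_le P _ _ b0 t0.
have sq := gint_Re_sqr P P0.
have pn : gint (fun p => complex.Re P.[cpt p] ^+ 2) =
    gint (fun p => posp P p ^+ 2) + gint (fun p => negp P p ^+ 2).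
  rewrite -gintD; last 2 first.
  - by apply: subgaussX; exact: subgauss_posp.
  - by apply: subgaussX; exact: subgauss_negp.
  apply: eq_gint => p; rewrite /posp /negp; set x := complex.Re _.
  have [x0|x0] := leP 0 x.
    by rewrite max_r ?oppr_le0// expr0n addr0.
  by rewrite max_l ?oppr_ge0 ?(ltW x0)// expr0n add0r sqrrN.
rewrite -!/(gint _) in neg.
have pi0 : 0 < pi :> R := pi_gt0 R.
(* For [b = 1 / 126] the ratio (b + 1/2) / b is 64, and 64 * 8^3 = 8^5 while 64 / 8^3 = 1/8. *)
have e (c A N L : R) : c != 0 -> 2 * (126^-1 + 2^-1) / c *
    (c / (2 * 126^-1) * (8 ^+ 3 * A + (8 ^+ 3)^-1 * N) + c / (126^-1 + 2^-1) * L) =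
  8 ^+ 5 * A + 8^-1 * N + 2 * L by move=> c0; field.
have H0 : 0 <= gint (fun p => posp P p ^+ 2) by apply: gint_ge0 => p; exact: sqr_ge0.
move: neg; rewrite e ?gt_eqF// => neg.
(* Collecting terms, N / 8 <= (1 + 8^5 + 8 * 528) H, that is N <= 295944 H. *)
have arith (N H Ng S L k : R) : 0 <= H -> S = N / 2 -> S = H + Ng ->
    Ng <= 8 ^+ 5 * H + 8^-1 * N + 2 * L -> 2 * L <= 4^-1 * N + 8 * k ->
    k <= 528 * H -> N <= 3 * 10 ^+ 5 * H by lra.
exact: arith H0 sq pn neg low fc.
Qed.
End Main.

(** * Stability *)

Section Final.
Context {R : realType}.
Local Open Scope complex_scope.
Implicit Types (F f g h rho : R * R -> R) (p q : R * R) (Q : {poly R[i]}).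

Notation nc := Normc.normc.

Lemma fock_normE (F : R[i] -> R[i]) : subgauss (fun p => nc (F (cpt p))) ->
  fock_norm F = (Num.sqrt (gint (fun p => nc (F (cpt p)) ^+ 2) / pi))%:E.
Proof.
move=> sF; rewrite /fock_norm.
have -> : (\int[lam2]_(p in [set: R * R]) ((nc (F (p.1 +i* p.2)) ^+ 2 *
    expR (- nc (p.1 +i* p.2) ^+ 2))%R)%:E)%E = (gint (fun p => nc (F (cpt p)) ^+ 2))%:E.
  rewrite /gint -gdecay_integral; last exact: gdecay_sqr.
  by apply: eq_integral => p _; rewrite -normc_cpt.
rewrite -EFinM poweR_EFin powR12_sqrt; first by rewrite mulrC.
by rewrite mulr_ge0 ?invr_ge0 ?pi_ge0//; apply: gint_ge0 => p; exact: sqr_ge0.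
Qed.

Lemma gint_pythagoras (c : R[i]) Q : Q.[0] = 0 ->
  gint (fun p => nc (c + Q.[cpt p]) ^+ 2) =
  nc c ^+ 2 * pi + gint (fun p => nc Q.[cpt p] ^+ 2).
Proof.
move=> Q0; have sQ := subgaussX _ 2 (subgauss_normc Q).
transitivity (gint (fun p => (nc c ^+ 2 + nc Q.[cpt p] ^+ 2) +
    2 * (complex.Re (c^*%:P * Q).[cpt p] * 1))).
  by apply: eq_gint => p; rewrite normc_sqrD hornerCM mulr1.
have s1 : subgauss (fun p => complex.Re (c^*%:P * Q).[cpt p] * 1).
  exact: subgaussM (subgauss_Re _) (subgauss_cst _).
rewrite gintD; last 2 first.
- exact: subgaussD (subgauss_cst _) sQ.
- exact: subgaussM (subgauss_cst _) s1.
rewrite gintD//; last exact: subgauss_cst.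
rewrite (gintZ _ _ s1) gint_mean_value//; last exact: subgauss_cst.
by rewrite hornerCM Q0 mulr0 mul0r mulr0 addr0 gint_cst.
Qed.

Lemma normc_real (x : R) : nc x%:C = `|x|.
Proof. by rewrite /= expr0n addr0 sqrtr_sqr. Qed.

Lemma dist_normc1_le (z : R[i]) : `|nc (1 + z) - 1| <= nc z.
Proof.
rewrite ler_norml; apply/andP; split.
  rewrite lerBrDr addrC lerBlDr -{1}(@Normc.normc1 R) -[X in nc X <= _](addrK z).
  by rewrite (le_trans (le_normcD _ _))// normcN.
by rewrite lerBlDr addrC (le_trans (le_normcD _ _))// Normc.normc1.
Qed.

(** The concluding arithmetic: [d] bounds the norm of P, [eta] is the norm of |1 + P| - 1, [n] the
    squared norm of Q, [x] the size of the constant shift and [p0] that of P(0). Smallness of [d]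
    makes [n + x ^+ 2] a small multiple of [eta + x], which allows [x] to be absorbed. *)
Lemma stability_arith (d eta n x p0 : R) : 0 <= d <= (4 * 10 ^+ 3)^-1 ->
  0 <= eta -> 0 <= n -> 0 <= x <= p0 -> p0 ^+ 2 + n <= d ^+ 2 ->
  n <= 6 * 10 ^+ 5 * (eta ^+ 2 + x ^+ 2) -> x <= eta + (n + x ^+ 2) / 2 ->
  n + x ^+ 2 <= (2 * 10 ^+ 3 * eta) ^+ 2.
Proof.
move=> /andP[d0 dle] eta0 n0 /andP[x0 xp] pn nle xle.
pose v := Num.sqrt n.
have v0 : 0 <= v by exact: sqrtr_ge0.
have v2 : v ^+ 2 = n by rewrite sqr_sqrtr.
have vd : v <= d.
  by rewrite -(@ler_pXn2r _ 2%N) ?nnegrE// v2 (le_trans _ pn)// lerDr sqr_ge0.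
have xd : x <= d.
  have p00 : 0 <= p0 by exact: le_trans xp.
  apply: (le_trans xp).
  by rewrite -(@ler_pXn2r _ 2%N) ?nnegrE// (le_trans _ pn)// lerDl.
(* Chosen because 775^2 exceeds 6 * 10^5. *)
have ex0 : 0 <= 775 * (eta + x) by rewrite mulr_ge0 ?ler0n ?addr_ge0.
have vle : v <= 775 * (eta + x).
  rewrite -(@ler_pXn2r _ 2%N) ?nnegrE// v2 (le_trans nle)//.
  have := mulr_ge0 eta0 x0; have := sqr_ge0 eta; have := sqr_ge0 x.
  by rewrite exprMn sqrrD; lra.
(* One factor of [n = v ^+ 2] is bounded by [d], the other by [eta + x]: the quadratic term becomes
   linear and small. *)
have nd : n <= d * (775 * (eta + x)) by rewrite -v2 expr2 ler_pM.
have x2d : x ^+ 2 <= d * x by rewrite expr2; exact: ler_wpM2r.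
have nd' : n <= (4 * 10 ^+ 3)^-1 * (775 * (eta + x)).
  by apply: (le_trans nd); exact: ler_wpM2r.
have x2d' : x ^+ 2 <= (4 * 10 ^+ 3)^-1 * x.
  by apply: (le_trans x2d); exact: ler_wpM2r.
have x2eta : x <= 2 * eta by lra.
have xsq : x ^+ 2 <= 4 * eta ^+ 2.
  have -> : 4 * eta ^+ 2 = (2 * eta) ^+ 2 by rewrite exprMn -natrX.
  by rewrite lerXn2r ?nnegrE// mulr_ge0.
have := sqr_ge0 eta; rewrite exprMn; lra.
Qed.

Lemma phase_stable_of_le (d m : R) : 0 <= d <= (4 * 10 ^+ 3)^-1 ->
  2 * 10 ^+ 3 <= m -> phase_stable d m.
Proof.
move=> dle mge P.
have pi0 : 0 < pi :> R := pi_gt0 R.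
have s1P : subgauss (fun p => nc (1 + P.[cpt p])).
  have := subgauss_normc (1%:P + P).
  by under eq_fun do rewrite hornerD hornerC.
have sA : subgauss (fun p => nc (1 + P.[cpt p]) - 1) by exact: subgaussD (subgauss_cst _).
have ncA p : nc (`|1 + P.[cpt p]| - 1) = `|nc (1 + P.[cpt p]) - 1|.
  by rewrite -normc_real rmorphB.
rewrite (fock_normE (horner P)); last exact: subgauss_normc.
rewrite lee_fin => Pd.
(* The phase makes the value at 0 of g (1 + P) real and nonnegative; [x] is its distance from 1,
   with sign, and [Q] the part vanishing at 0. *)
have [g g1 gP] := exists_phase (1 + P.[0]).
pose x := nc (1 + P.[0]) - 1.
pose Q := g%:P * (P - P.[0]%:P).
have Q0 : Q.[0] = 0 by rewrite hornerCM hornerD hornerN hornerC subrr mulr0.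
have xC : x%:C = g * (1 + P.[0]) - 1.
  by rewrite gP; apply/eqP; rewrite eq_complex /= subrr !eqxx.
have fE z : g * (1 + P.[z]) - 1 = x%:C + Q.[z].
  by rewrite xC hornerCM hornerD hornerN hornerC; ring.
exists g; first by rewrite [`|g|]/(`|g|) -[LHS]/((nc g)%:C) g1.
have sf : subgauss (fun p => nc (g * (1 + P.[cpt p]) - 1)).
  have := subgauss_normc (x%:C%:P + Q).
  by under eq_fun do rewrite hornerD hornerC -fE.
rewrite !fock_normE//; last by under eq_fun do rewrite ncA; exact: subgauss_norm.
rewrite -EFinM lee_fin.
set n := gint (fun p => nc Q.[cpt p] ^+ 2) / pi.
set A := fun p => nc (1 + P.[cpt p]) - 1.
set eta2 := gint (fun p => A p ^+ 2) / pi.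
have -> : gint (fun p => nc (`|1 + P.[cpt p]| - 1) ^+ 2) / pi = eta2.
  by congr (_ / _); apply: eq_gint => p; rewrite ncA real_normK ?num_real.
have fnE : gint (fun p => nc (g * (1 + P.[cpt p]) - 1) ^+ 2) = (n + x ^+ 2) * pi.
  rewrite (eq_gint _ (fun p => nc (x%:C + Q.[cpt p]) ^+ 2)); last by move=> p; rewrite fE.
  rewrite gint_pythagoras// normc_real real_normK ?num_real// addrC mulrDl.
  by rewrite divfK// gt_eqF.
have n0 : 0 <= n by rewrite divr_ge0 ?(ltW pi0)//; apply: gint_ge0 => p; exact: sqr_ge0.
have eta20 : 0 <= eta2.
  by rewrite divr_ge0 ?(ltW pi0)//; apply: gint_ge0 => p; exact: sqr_ge0.
rewrite fnE mulfK ?gt_eqF//.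
set eta := Num.sqrt eta2.
have eta0 : 0 <= eta by exact: sqrtr_ge0.
have etaE : eta ^+ 2 = eta2 by rewrite sqr_sqrtr.
have m0 : 0 <= m by rewrite (le_trans _ mge)// mulr_ge0// exprn_ge0.
rewrite -(@ler_pXn2r _ 2%N) ?nnegrE ?sqrtr_ge0 ?mulr_ge0// sqr_sqrtr; last first.
  by rewrite addr_ge0 ?sqr_ge0.
apply: (@le_trans _ _ ((2 * 10 ^+ 3 * eta) ^+ 2)); last first.
  rewrite lerXn2r ?nnegrE ?mulr_ge0 ?exprn_ge0// ler_wpM2r//.
rewrite -[x ^+ 2]real_normK ?num_real//.
apply: (stability_arith d eta n `|x| (nc P.[0])) => //.
- by rewrite normr_ge0 dist_normc1_le.
(* Multiplication by [g] preserves the norm, so [n] is also the squared norm of P - P(0). *)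
- have PE : gint (fun p => nc P.[cpt p] ^+ 2) = (nc P.[0] ^+ 2 + n) * pi.
    rewrite (eq_gint _ (fun p => nc (P.[0] + (P - P.[0]%:P).[cpt p]) ^+ 2)); last first.
      by move=> p; rewrite hornerD hornerN hornerC addrC subrK.
    rewrite gint_pythagoras; last by rewrite hornerD hornerN hornerC subrr.
    rewrite mulrDl divfK ?gt_eqF//; congr (_ + _); apply: eq_gint => p.
    by rewrite hornerCM Normc.normcM g1 mul1r.
  move: Pd; rewrite PE mulfK ?gt_eqF// => Pd.
  rewrite -[leLHS]sqr_sqrtr ?addr_ge0 ?sqr_ge0// lerXn2r ?nnegrE ?sqrtr_ge0//.
  by case/andP: dle.
- have := one_sided_bound Q Q0; rewrite real_normK ?num_real//.
  (* From Re Q = Re f - 1 - x <= |A| + |x| with f = g (1 + P); expanding the square doubles 3 * 10^5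
     to 6 * 10^5. *)
  have : gint (fun p => posp Q p ^+ 2) <= gint (fun p => 2 * A p ^+ 2 + 2 * x ^+ 2).
    apply: le_gint.
    + exact/subgaussX/subgauss_posp.
    + apply: subgaussD (subgauss_cst _); apply: subgaussM (subgauss_cst _) _.
      exact: subgaussX.
    move=> p; rewrite (@le_trans _ _ ((`|A p| + `|x|) ^+ 2))//.
      rewrite lerXn2r ?nnegrE ?posp_ge0 ?addr_ge0// ge_max addr_ge0// andbT.
      have -> : complex.Re Q.[cpt p] = complex.Re (g * (1 + P.[cpt p])) - 1 - x.
        by have := congr1 (@complex.Re R) (fE (cpt p)); rewrite !Re_add Re_opp /=; lra.
      rewrite -[`|x|]normrN (le_trans _ (lerD (ler_norm _) (ler_norm _)))// lerD2r.
      by rewrite lerD2r (le_trans (Re_le_normc _))// Normc.normcM g1 mul1r.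
    rewrite sqrrD !real_normK ?num_real//.
    have := sqr_ge0 (`|A p| - `|x|); rewrite sqrrB !real_normK ?num_real//; lra.
  rewrite gintD; last 2 first.
  - by apply: subgaussM (subgauss_cst _) _; exact: subgaussX.
  - exact: subgauss_cst.
  rewrite gintZ; last exact: subgaussX.
  rewrite gint_cst etaE.
  have -> : gint (fun p => A p ^+ 2) = eta2 * pi by rewrite divfK// gt_eqF.
  have -> : gint (fun p => nc Q.[cpt p] ^+ 2) = n * pi by rewrite divfK// gt_eqF.
  move=> h1 h2; rewrite -(ler_pM2r pi0).
  have arith (H N e y k : R) : H <= 2 * (e * k) + 2 * y * k ->
      N * k <= 3 * 10 ^+ 5 * H -> N * k <= 6 * 10 ^+ 5 * (e + y) * k.
    by move=> h3 h4; lra.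
  exact: arith h1 h2.
(* It remains to bound |x|. Up to the factor [pi], [x] is the Gaussian integral of Re f - 1, which
   is estimated from both sides. *)
pose f p := g * (1 + P.[cpt p]).
have ReE p : complex.Re (x%:C + Q.[cpt p]) = complex.Re (f p) - 1.
  by rewrite -fE Re_add Re_opp.
have fA p : nc (f p) - 1 = A p by rewrite Normc.normcM g1 mul1r.
have sRe : subgauss (fun p => complex.Re (x%:C + Q.[cpt p])).
  by have := subgauss_Re (x%:C%:P + Q); under eq_fun do rewrite hornerD hornerC.
have snA : subgauss (fun p => `|A p|) by exact: subgauss_norm.
have xpi : gint (fun p => complex.Re (x%:C + Q.[cpt p])) = x * pi.
  rewrite (eq_gint _ (fun p => complex.Re (x%:C%:P + Q).[cpt p] * 1)); last first.
    by move=> p; rewrite hornerD hornerC mulr1.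
  rewrite gint_mean_value; [|exact: subgauss_cst|by []].
  by rewrite hornerD hornerC Q0 addr0 gint_cst mul1r.
(* Cauchy-Schwarz against the constant 1, whose Gaussian mass is [pi]. *)
have Ale : gint (fun p => `|A p|) <= eta * pi.
  rewrite -(@ler_pXn2r _ 2%N) ?nnegrE ?mulr_ge0 ?(ltW pi0)//; last first.
    exact: gint_ge0.
  have := gint_CauchySchwarz _ _ snA (subgauss_cst 1).
  rewrite (eq_gint (fun p => `|A p| * 1) (fun p => `|A p|)); last first.
    by move=> p; rewrite mulr1.
  move/le_trans; apply.
  rewrite (eq_gint (fun=> 1 ^+ 2) (fun=> 1)); last by move=> p; rewrite expr1n.
  rewrite (eq_gint _ (fun p => A p ^+ 2)); last by move=> p; rewrite real_normK ?num_real.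
  rewrite gint_cst mul1r exprMn etaE /eta2 le_eqVlt; apply/orP; left; apply/eqP.
  by rewrite expr2 mulrA divfK// gt_eqF.
have up : gint (fun p => complex.Re (x%:C + Q.[cpt p])) <= gint (fun p => `|A p|).
  apply: le_gint => // p.
  by rewrite ReE (le_trans _ (ler_norm _))// -fA lerD2r Re_le_normc.
(* From |f - 1|^2 = A^2 + 2 (|f| - Re f) one gets 1 - Re f <= |A| + |f - 1|^2 / 2. *)
have dn : - gint (fun p => complex.Re (x%:C + Q.[cpt p])) <=
    gint (fun p => `|A p|) + 2^-1 * ((n + x ^+ 2) * pi).
  have sf2 := subgaussX _ 2 sf.
  rewrite -fnE -[X in X <= _]mulN1r -(gintZ _ _ sRe) -(gintZ _ _ sf2).
  have s2 : subgauss (fun p => 2^-1 * nc (g * (1 + P.[cpt p]) - 1) ^+ 2).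
    by apply: subgaussM (subgauss_cst _) _; exact: subgaussX.
  rewrite -gintD//; apply: le_gint.
  - exact: subgaussM (subgauss_cst _) sRe.
  - exact: subgaussD.
  move=> p; rewrite ReE -/(f p).
  have -> : nc (f p - 1) ^+ 2 = A p ^+ 2 + 2 * (nc (f p) - complex.Re (f p)).
    rewrite -fA normc_sqrD normcN Normc.normc1 sqrrB.
    by case: (f p) => a b; rewrite Re_mul /=; ring.
  have := ler_norm (- A p); rewrite normrN -fA; have := sqr_ge0 (nc (f p) - 1).
  lra.
rewrite real_normK ?num_real// -(ler_pM2r pi0).
have arith (X S T e k : R) : X <= S -> - X <= S + 2^-1 * (T * k) -> S <= e * k ->
    0 <= T * k -> `|X| <= (e + T / 2) * k.
  by move=> h1 h2 h3 h4; rewrite ler_norml; apply/andP; split; lra.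
rewrite -[X in _ * X](ger0_norm (ltW pi0)) -normrM -xpi.
apply: arith up dn Ale _.
exact: mulr_ge0 (addr_ge0 n0 (sqr_ge0 x)) (ltW pi0).
Qed.

End Final.

Theorem theorem1p4 (R : realType) :
  (exists delta M : R, [/\ 0 < delta, 0 < M & phase_stable delta M]) /\
  phase_stable (1 / 4601 : R) (23003 : R).
Proof.
have h : phase_stable (1 / 4601 : R) (23003 : R).
  (* The requested constants lie within the proved range: 1/4601 <= 1/4000 and 2000 <= 23003. *)
  apply: phase_stable_of_le.
    rewrite div1r invr_ge0 ler0n lef_pV2 ?posrE ?ltr0n ?mulr_gt0 ?exprn_gt0//.
    by rewrite -natrX -natrM ler_nat.
  by rewrite -natrX -natrM ler_nat.
split; last exact: h.
exists (1 / 4601), 23003; split; last exact: h.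
  by rewrite div1r invr_gt0 ltr0n.
by rewrite ltr0n.
Qed.
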